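(* Let $G$ be a compact Lie group and let $\tau$ be an irreducible (finite-dimensional complex) representation of $G$ whose character $\chi^{\tau}$ is not real valued. Let $\alpha\in G$, $\alpha\neq 1$, be such that $\alpha$ and $\alpha^{-1}$ are conjugate in $G$, set $a=1-\frac{\chi^{\tau}(\alpha)}{\dim(\tau)}$, and assume $a\neq 0$. Let $W=\frac{1}{\sqrt{2}} \left( \chi^{\tau}(g) + \overline{\chi^{\tau}(g)} \right)$ where $g$ is chosen from the Haar measure of $G$. Then for all real $x_0$, $$\left| \mathbb{P}(W \leq x_0) - \frac{1}{\sqrt{2 \pi}} \int_{-\infty}^{x_0} e^{-\frac{x^2}{2}}\, dx \right| \leq \frac{1}{2} \sqrt{\sum_{\phi\neq 1} m_{\phi}[(\tau+\overline{\tau})^2]^2 \left[ 2- \frac{1}{a} \left( 1-\frac{\chi^{\phi}(\alpha)}{\dim(\phi)} \right) \right]^2} + \left[ \frac{1}{\pi} \sum_{\phi} m_{\phi}[(\tau+\overline{\tau})^2]^2 \left(2 - \frac{3}{2a} \left(1-\frac{\chi^{\phi}(\alpha)}{\dim(\phi)} \right) \right) \right]^{1/4},$$ where the first sum is over all non-trivial irreducible representations $\phi$ of $G$, and the second sum is over all irreducible representations $\phi$ of $G$.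
   Context: Haar measure is normalized to be a probability measure. For an irreducible representation $\phi$ of $G$, $\chi^{\phi}$ denotes its character and $\dim(\phi)$ its dimension; sums over irreducible representations are over isomorphism classes. $\overline{\tau}$ is the complex conjugate (dual) representation of $\tau$, with character $\overline{\chi^{\tau}}$, and $m_{\phi}[(\tau+\overline{\tau})^r]$ denotes the multiplicity of $\phi$ in the $r$-fold tensor product of $\tau\oplus\overline{\tau}$ (which has character $(\chi^{\tau}+\overline{\chi^{\tau}})^r$). Since $\alpha$ is conjugate to $\alpha^{-1}$, all $\chi^{\phi}(\alpha)$ are real. *)

(* Defs.v *)
From HB Require Import structures.
From mathcomp Require Import all_boot all_order all_algebra.
From mathcomp Require Import all_classical all_reals all_analysis.
From mathcomp Require Import complex mxtens.

Set Implicit Arguments.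
Unset Strict Implicit.
Unset Printing Implicit Defensive.

Import Order.TTheory GRing.Theory Num.Theory.
Import numFieldNormedType.Exports.

Local Open Scope classical_set_scope.
Local Open Scope ring_scope.

HB.mixin Record isTopologicalGroup G of Group G & PointedTopological G := {
  mulg_continuous : continuous (fun x : G * G => (x.1 * x.2)%g);
  invg_continuous : continuous (fun x : G => (x^-1)%g)
}.

(* The distinguished point is only there because the measurable types of the
   library are pointed. *)
#[short(type="topologicalGroupType")]
HB.structure Definition TopologicalGroup :=
  {G of isTopologicalGroup G & Group G & PointedTopological G}.

(* [G] seen as a measurable space with its Borel sigma-algebra *)
Notation borel G := (g_sigma_algebraType (@open G)).

(* As [mu] is a probability, a left-invariant [mu] is the normalized Haar
   measure: on a compact Lie group, regularity and right invariance follow. *)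
Definition haar (R : realType) (G : topologicalGroupType)
    (mu : probability (borel G) R) : Prop :=
  forall (g : G) (A : set (borel G)), measurable A ->
    mu [set (g * x)%g | x in (A : set G)] = mu A.

Section Smooth.
Variables (R : realType) (m n : nat).

(* [f] is of class C^k on the open set [U]: its directional derivatives exist
   and are of class C^(k-1). *)
Fixpoint class_C (k : nat) (U : set 'rV[R]_m) (f : 'rV[R]_m -> 'rV[R]_n) :
    Prop :=
  if k is k'.+1 then
    forall v : 'rV[R]_m,
      (forall x, U x -> derivable f x v) /\ class_C k' U (fun x => 'D_v f x)
  else forall x, U x -> {for x, continuous f}.

Definition smooth_on (U : set 'rV[R]_m) (f : 'rV[R]_m -> 'rV[R]_n) : Prop :=
  forall k, class_C k U f.

End Smooth.

(* The functions [chart_map] and [chart_inv] are total; their values outside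
   [chart_dom] and [chart_cod] are irrelevant. *)
Record chart (R : realType) (n : nat) (G : topologicalType) := Chart {
  chart_dom : set G;
  chart_cod : set 'rV[R]_n;
  chart_map : G -> 'rV[R]_n;
  chart_inv : 'rV[R]_n -> G;
  chart_dom_open : open chart_dom;
  chart_cod_open : open chart_cod;
  chart_map_cod : forall x, chart_dom x -> chart_cod (chart_map x);
  chart_inv_dom : forall y, chart_cod y -> chart_dom (chart_inv y);
  chart_mapK : forall x, chart_dom x -> chart_inv (chart_map x) = x;
  chart_invK : forall y, chart_cod y -> chart_map (chart_inv y) = y;
  chart_map_continuous :
    forall x, chart_dom x -> {for x, continuous chart_map};
  chart_inv_continuous :
    forall y, chart_cod y -> {for y, continuous chart_inv}
}.

(* [A] is a smooth atlas of dimension [n] on [G] making it a Lie group.  The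
   value [n = 0] is allowed, so that finite groups are compact Lie groups. *)
Record lie_atlas (R : realType) (n : nat) (G : topologicalGroupType)
    (A : set (chart R n G)) : Prop := LieAtlas {
  lie_hausdorff : hausdorff_space G;
  lie_second_countable : @second_countable G;
  lie_cover : forall x : G, exists2 c, A c & chart_dom c x;
  lie_compat : forall c d, A c -> A d ->
    smooth_on
      [set y | chart_cod c y /\ chart_dom d (chart_inv c y)]
      (fun y => chart_map d (chart_inv c y));
  lie_mulg_smooth : forall c d e, A c -> A d -> A e ->
    smooth_on
      [set p : 'rV[R]_(n + n) |
        [/\ chart_cod c (lsubmx p), chart_cod d (rsubmx p) &
            chart_dom e (chart_inv c (lsubmx p) * chart_inv d (rsubmx p))%g]]
      (fun p => chart_map e
                  (chart_inv c (lsubmx p) * chart_inv d (rsubmx p))%g);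
  lie_invg_smooth : forall c d, A c -> A d ->
    smooth_on
      [set y | chart_cod c y /\ chart_dom d ((chart_inv c y)^-1)%g]
      (fun y => chart_map d ((chart_inv c y)^-1)%g)
}.

Definition mx_continuous (R : realType) (T : topologicalType) (m n : nat)
    (f : T -> 'M[R[i]]_(m, n)) : Prop :=
  forall i j, continuous (fun x => f x i j : R[i]^o).

Lemma continuous_conj (K : numClosedFieldType) (T : topologicalType)
    (f : T -> K) :
  continuous (f : T -> K^o) -> continuous (fun x => (f x)^* : K^o).
Proof.
move=> cf x; apply/cvgrPdist_lt => e e0.
have /cvgrPdist_lt/(_ e e0) := cf x.
by apply: filterS => y; rewrite -rmorphB /= norm_conjC.
Qed.

Lemma continuous_mul (K : numFieldType) (T : topologicalType) (f g : T -> K) :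
  continuous (f : T -> K^o) -> continuous (g : T -> K^o) ->
  continuous (fun x => f x * g x : K^o).
Proof. by move=> cf cg x; apply: cvgM; [exact: cf|exact: cg]. Qed.

Section Rep.
Variables (R : realType) (G : topologicalGroupType).
Local Notation C := R[i].

(* A representation of [G] on the column vectors of [C^rep_dim] *)
Record rep := Rep {
  rep_dim : nat;
  rep_mx :> G -> 'M[C]_rep_dim;
  rep_1 : rep_mx 1%g = 1%:M;
  rep_M : forall g h, rep_mx (g * h)%g = rep_mx g *m rep_mx h;
  rep_continuous : mx_continuous rep_mx
}.

HB.instance Definition _ := gen_eqMixin rep.
HB.instance Definition _ := gen_choiceMixin rep.

Implicit Types (rho sigma phi : rep).

Definition rep_char rho (g : G) : C := \tr (rho g).

Definition rep_irreducible rho : Prop :=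
  (0 < rep_dim rho)%N /\
  forall U : {vspace 'cV[C]_(rep_dim rho)},
    (forall g v, v \in U -> rho g *m v \in U) -> U = 0%VS \/ U = fullv.

Definition rep_iso rho sigma : Prop :=
  exists (P : 'M[C]_(rep_dim sigma, rep_dim rho))
         (Q : 'M[C]_(rep_dim rho, rep_dim sigma)),
    [/\ P *m Q = 1%:M, Q *m P = 1%:M &
        forall g, P *m rho g = sigma g *m P].

Lemma rep_iso_refl rho : rep_iso rho rho.
Proof. by exists 1%:M, 1%:M; split=> [||g]; rewrite ?mul1mx ?mulmx1. Qed.

Lemma rep_iso_sym rho sigma : rep_iso rho sigma -> rep_iso sigma rho.
Proof.
move=> [P [Q [PQ QP PI]]]; exists Q, P; split=> // g.
by rewrite -[LHS]mulmx1 -PQ -mulmxA (mulmxA (sigma g)) -PI !mulmxA QP mul1mx.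
Qed.

Lemma rep_iso_trans rho sigma phi :
  rep_iso rho sigma -> rep_iso sigma phi -> rep_iso rho phi.
Proof.
move=> [P [Q [PQ QP PI]]] [P' [Q' [PQ' QP' PI']]].
exists (P' *m P), (Q *m Q'); split=> [||g].
- by rewrite mulmxA -(mulmxA P') PQ mulmx1.
- by rewrite mulmxA -(mulmxA Q) QP' mulmx1.
- by rewrite -mulmxA PI !mulmxA PI'.
Qed.

Lemma rep_irreducible_iso rho sigma :
  rep_iso rho sigma -> rep_irreducible rho -> rep_irreducible sigma.
Proof.
move=> [P [Q [PQ QP PI]]] [rho_gt0 irr_rho]; split=> [|U stU].
  rewrite lt0n; apply/negP => /eqP sigma0.
  move: P Q QP {PQ PI}; rewrite sigma0 => P Q /matrixP.
  move/(_ (Ordinal rho_gt0) (Ordinal rho_gt0)); rewrite !mxE big_ord0 eqxx.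
  by move/eqP; rewrite eq_sym oner_eq0.
pose f := linfun (mulmx P : 'cV_(rep_dim rho) -> 'cV_(rep_dim sigma)).
have memf v : (v \in f @^-1: U)%VS = (P *m v \in U).
  by rewrite -memv_preim lfunE.
case: (irr_rho (f @^-1: U)%VS) => [g v|fU0|fUT].
- by rewrite !memf mulmxA PI -mulmxA => /stU.
- left; apply/eqP; rewrite -subv0; apply/subvP => v vU.
  have : Q *m v \in (f @^-1: U)%VS by rewrite memf mulmxA PQ mul1mx.
  rewrite fU0 !memv0 => /eqP Qv0.
  by rewrite -[v]mul1mx -PQ -mulmxA Qv0 mulmx0.
- right; apply/eqP; rewrite eqEsubv subvf /=; apply/subvP => v _.
  have : Q *m v \in (f @^-1: U)%VS by rewrite fUT memvf.
  by rewrite memf mulmxA PQ mul1mx.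
Qed.

(* The representatives, one per isomorphism class, of the irreducible
   representations; [irr_repsP] below is the property that matters. *)
Definition irr_reps : set rep :=
  [set phi | rep_irreducible phi /\ phi = xget phi [set psi | rep_iso phi psi]].

Lemma irr_repsP rho : rep_irreducible rho ->
  exists! phi, irr_reps phi /\ rep_iso rho phi.
Proof.
have isoE phi psi : rep_iso phi psi ->
    xget phi [set x | rep_iso phi x] = xget psi [set x | rep_iso psi x].
  move=> iso_pp.
  have -> : [set x | rep_iso phi x] = [set x | rep_iso psi x].
    apply/seteqP; split=> x /=; apply: rep_iso_trans => //.
    exact: rep_iso_sym.
  by rewrite /xget; case: pselect => // -[]; exists psi; apply/asboolP;
     exact: rep_iso_refl.
move=> irr_rho; set phi := xget rho [set psi | rep_iso rho psi].
have iso_phi : rep_iso rho phi.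
  by apply: (@xgetPex _ _ [set psi | rep_iso rho psi]); exists rho;
     exact: rep_iso_refl.
exists phi; split=> [|psi [[_ psiE] /isoE rho_psi]];
  last by rewrite psiE -rho_psi.
split=> //; split; first exact: rep_irreducible_iso irr_rho.
by rewrite -(isoE _ _ iso_phi).
Qed.

Fact rep_id_1 n : (fun _ : G => 1%:M : 'M[C]_n) 1%g = 1%:M.
Proof. by []. Qed.

Fact rep_id_M n (g h : G) :
  (fun _ : G => 1%:M : 'M[C]_n) (g * h)%g = 1%:M *m 1%:M.
Proof. by rewrite mul1mx. Qed.

Fact rep_id_continuous n : mx_continuous (fun _ : G => 1%:M : 'M[C]_n).
Proof. by move=> i j; exact: cst_continuous. Qed.

Definition rep_id (n : nat) : rep :=
  Rep (@rep_id_1 n) (@rep_id_M n) (@rep_id_continuous n).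

Definition rep_triv : rep := rep_id 1.

Definition rep_zero : rep := rep_id 0.

Definition rep_conj_mx rho (g : G) :
    'M[C]_(rep_dim rho) :=
  map_mx Num.conj (rho g).

Fact rep_conj_1 rho : rep_conj_mx rho 1%g = 1%:M.
Proof. by rewrite /rep_conj_mx rep_1 map_mx1. Qed.

Fact rep_conj_M rho g h :
  rep_conj_mx rho (g * h)%g =
    rep_conj_mx rho g *m rep_conj_mx rho h.
Proof.
by rewrite /rep_conj_mx rep_M map_mxM.
Qed.

Fact rep_conj_continuous rho : mx_continuous (rep_conj_mx rho).
Proof.
move=> i j; rewrite (_ : (fun _ => _) = (fun g => (rho g i j)^* : C^o)).
  exact/continuous_conj/rep_continuous.
by apply/funext => g; rewrite mxE.
Qed.

Definition rep_conj rho : rep :=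
  Rep (rep_conj_1 rho) (rep_conj_M rho) (@rep_conj_continuous rho).

Definition rep_dsum_mx rho sigma (g : G) :
    'M[C]_(rep_dim rho + rep_dim sigma) :=
  block_mx (rho g) 0 0 (sigma g).

Fact rep_dsum_1 rho sigma : rep_dsum_mx rho sigma 1%g = 1%:M.
Proof. by rewrite /rep_dsum_mx !rep_1 -scalar_mx_block. Qed.

Fact rep_dsum_M rho sigma g h :
  rep_dsum_mx rho sigma (g * h)%g =
    rep_dsum_mx rho sigma g *m rep_dsum_mx rho sigma h.
Proof.
by rewrite /rep_dsum_mx !rep_M mulmx_block !mul0mx !mulmx0 !addr0 !add0r.
Qed.

Fact rep_dsum_continuous rho sigma : mx_continuous (rep_dsum_mx rho sigma).
Proof.
move=> i j; case: (split_ordP i) => i' ->; case: (split_ordP j) => j' ->.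
- rewrite (_ : (fun _ => _) = (fun g => rho g i' j' : C^o)).
    exact: rep_continuous.
  by apply/funext => g; rewrite block_mxEul.
- rewrite (_ : (fun _ => _) = (fun _ => 0 : C^o)); first exact: cst_continuous.
  by apply/funext => g; rewrite block_mxEur mxE.
- rewrite (_ : (fun _ => _) = (fun _ => 0 : C^o)); first exact: cst_continuous.
  by apply/funext => g; rewrite block_mxEdl mxE.
- rewrite (_ : (fun _ => _) = (fun g => sigma g i' j' : C^o)).
    exact: rep_continuous.
  by apply/funext => g; rewrite block_mxEdr.
Qed.

Definition rep_dsum rho sigma : rep :=
  Rep (rep_dsum_1 rho sigma) (rep_dsum_M rho sigma)
    (@rep_dsum_continuous rho sigma).

Definition rep_tens_mx rho sigma (g : G) :
    'M[C]_(rep_dim rho * rep_dim sigma) :=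
  rho g *t sigma g.

Fact rep_tens_1 rho sigma : rep_tens_mx rho sigma 1%g = 1%:M.
Proof.
rewrite /rep_tens_mx !rep_1; apply/matrixP => i j.
case: (mxtens_indexP i) => i0 i1; case: (mxtens_indexP j) => j0 j1.
rewrite tensmxE !mxE -natrM mulnb (can_eq (@mxtens_indexK _ _)).
by rewrite xpair_eqE.
Qed.

Fact rep_tens_M rho sigma g h :
  rep_tens_mx rho sigma (g * h)%g =
    rep_tens_mx rho sigma g *m rep_tens_mx rho sigma h.
Proof.
by rewrite /rep_tens_mx !rep_M tensmx_mul.
Qed.

Fact rep_tens_continuous rho sigma : mx_continuous (rep_tens_mx rho sigma).
Proof.
move=> i j; case: (mxtens_indexP i) => i0 i1; case: (mxtens_indexP j) => j0 j1.
rewrite (_ : (fun _ => _) = (fun g => rho g i0 j0 * sigma g i1 j1 : C^o)).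
  exact/continuous_mul/rep_continuous/rep_continuous.
by apply/funext => g; rewrite tensmxE.
Qed.

Definition rep_tens rho sigma : rep :=
  Rep (rep_tens_1 rho sigma) (rep_tens_M rho sigma)
    (@rep_tens_continuous rho sigma).

Definition rep_exp rho (r : nat) : rep := iterop r rep_tens rho rep_triv.

(* The multiplicity of the irreducible [phi] in [rho]: the number of summands
   isomorphic to [phi] in a decomposition of [rho] into irreducibles *)
Definition rep_mult phi rho : nat :=
  xget 0%N [set k | exists s : seq rep,
    [/\ forall sigma, sigma \in s -> rep_irreducible sigma,
        rep_iso rho (foldr rep_dsum rep_zero s) &
        k = count (fun sigma => `[< rep_iso phi sigma >]) s]].

(* The character ratio chi^phi(alpha) / dim(phi), which is real when [alpha]
   is conjugate to its inverse *)
Definition char_ratio phi (alpha : G) : R :=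
  complex.Re (rep_char phi alpha / (rep_dim phi)%:R).

(* The random variable (chi^tau + conj chi^tau) / sqrt 2, real-valued *)
Definition real_char_rv (tau : rep) (g : borel G) : R :=
  (Num.sqrt 2)^-1 * complex.Re (rep_char tau g + (rep_char tau g)^*).

End Rep.
Arguments rep_triv {R G}.
Arguments irr_reps {R G}.

(* Main.v *)
Require Import Defs.
From HB Require Import structures.
From mathcomp Require Import all_boot all_order all_algebra.
From mathcomp Require Import all_classical all_reals all_analysis.
From mathcomp Require Import measurable_realfun complex mxtens ring lra.
Import Order.TTheory GRing.Theory Num.Theory.
Import numFieldNormedType.Exports.
Local Open Scope classical_set_scope.
Local Open Scope ring_scope.

Set Implicit Arguments.
Unset Strict Implicit.
Unset Printing Implicit Defensive.

(* Stein's method with an exchangeable pair.  Let h be Haar distributed,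
   g' = (h^-1 alpha h) g, and W' the value of W at g'.  By Schur's lemma the
   conditional mean of chi^phi(g') given g is
   chi^phi(alpha) / dim(phi) * chi^phi(g); in particular that of W' is
   (1 - a) W, and (W, W') is exchangeable because alpha is conjugate to its
   inverse.  For the bounded solution f of Stein's equation
   f'(x) - x f(x) = u(x) - E u(Z), with Z a standard Gaussian and u a piecewise
   affine approximation, of slope at most 1/d, of the indicator of ]-oo, x0],
   exchangeability gives
   E[W f(W)] = E[(f(W') - f(W)) (W' - W)] / (2a), and the bounds |f'| <= 1 and
   Lip(f') <= 1/d give
   |E u(W) - E u(Z)| <= E|1 - E[(W' - W)^2 | g] / (2a)| + E|W' - W|^3 / (4ad).
   The first term is at most an L^2 norm.  The third moment is bounded by the
   second and the fourth, and the smoothing costs d / sqrt(2 pi); optimizing d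
   yields the fourth root.  Since 2 W^2 is the character of
   (tau + conj tau)^2, in which the trivial representation has multiplicity 2
   as chi^tau is not real, orthogonality of the irreducible characters turns
   the L^2 norm and the fourth moment into the two sums over phi. *)

(** * The Gaussian distribution function *)

(** The smoothing is forced. For the indicator of ]-oo, x0] itself, the derivative of the Stein
    solution jumps by 1 at x0, so the Taylor remainder of f(W') - f(W) would not be quadratic in W'
    - W. For a ramp only the second derivative jumps, at the two ends, and all derivatives are
    therefore taken away from these two points. The moments close up for the following reason.
    Averaging over h the translate of a combination of irreducible characters by h^-1 alpha h
    multiplies each chi^phi by chi^phi(alpha) / dim(phi). Up to degree four, E[W^3 W'] follows from
    the regression property, and only E[W^4] and E[W^2 W'^2] remain; both are quadratic in the
    multiplicities, which is why the second sum is affine in the character ratios. The first one is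
    quadratic in them, as it comes from the square of a conditional mean. *)

Section Calculus.
Variable R : realType.
Implicit Types (x y z b c d : R) (F dF : R -> R).

Lemma is_derive_continuous (F dF : R -> R) :
  (forall x, is_derive x 1 F (dF x)) -> continuous F.
Proof.
by move=> h x; apply/differentiable_continuous/derivable1_diffP; have [] := h x.
Qed.

(** The exceptional points [s] allow for functions such as [stein'], differentiated only away from
    the two ends of the ramp; an exceptional point inside the interval splits it in two. *)
Lemma ndecr_except F dF (s : seq R) x y : continuous F -> x <= y ->
  (forall z, x < z < y -> z \notin s ->
     is_derive z 1 F (dF z) /\ 0 <= dF z) ->
  F x <= F y.
Proof.
move=> cF; elim: s x y => [|b s IH] x y xy dFP.
  move: xy; rewrite le_eqVlt => /orP[/eqP ->//|xy].
  have [||c /[!in_itv]/= cxy E] := @MVT R F dF x y xy.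
  - by move=> z /[!in_itv]/= zxy; have [] := dFP z zxy isT.
  - exact/continuous_subspaceT.
  by rewrite -subr_ge0 E mulr_ge0 ?subr_ge0 ?(ltW xy)//;
    have [] := dFP c cxy isT.
have [/andP[xb yb]|nb] := boolP (x <= b <= y).
  apply: (@le_trans _ _ (F b)); apply: IH => // z /andP[h1 h2] zs; apply: dFP.
  - by rewrite h1 (lt_le_trans h2).
  - by rewrite inE negb_or zs lt_eqF.
  - by rewrite h2 (le_lt_trans xb).
  - by rewrite inE negb_or zs gt_eqF.
apply: IH => // z zxy zs; apply: dFP => //; rewrite inE negb_or zs andbT.
by apply: contraNneq nb => <-; case/andP: zxy => /ltW -> /ltW ->.
Qed.

End Calculus.

Section Gauss.
Variable R : realType.
Implicit Types (x y z b c d : R).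

Definition gauss_pdf x : R := (Num.sqrt (2 * pi))^-1 * expR (- (x ^+ 2 / 2)).

Definition gauss_cdf x : R := (Num.sqrt (2 * pi))^-1 *
  \int[lebesgue_measure]_(t in `]-oo, x]) expR (- (t ^+ 2 / 2)).

Lemma sqrt2pi_gt0 : 0 < Num.sqrt (2 * pi) :> R.
Proof. by rewrite sqrtr_gt0 mulr_gt0 ?pi_gt0. Qed.

Lemma gauss_pdf_gt0 x : 0 < gauss_pdf x.
Proof. by rewrite mulr_gt0 ?expR_gt0// invr_gt0 sqrt2pi_gt0. Qed.

Lemma gauss_pdf_le x : gauss_pdf x <= (Num.sqrt (2 * pi))^-1.
Proof.
rewrite ler_piMr ?invr_ge0 ?sqrtr_ge0// -[leRHS]expR0 ler_expR oppr_le0.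
by rewrite divr_ge0 ?sqr_ge0.
Qed.

Global Instance is_derive_gauss_pdf x :
  is_derive x 1 gauss_pdf (- (x * gauss_pdf x)).
Proof.
rewrite /gauss_pdf; apply: is_derive_eq.
rewrite !scaler0 ?addr0 ?add0r /GRing.scale/=.
by move: (Num.sqrt _)^-1 (expR _) => s e; field.
Qed.

Lemma gauss_pdfE : gauss_pdf = normal_pdf 0 1.
Proof.
apply/funext => x; rewrite normal_pdfE ?oner_eq0//.
rewrite /gauss_pdf /normal_peak /normal_fun expr1n subr0 mul1r mulNr.
by rewrite -[pi *+ 2]mulr_natl.
Qed.

Lemma integrable_gauss_pdf (A : set R) : measurable A ->
  lebesgue_measure.-integrable A (EFin \o gauss_pdf).
Proof.
move=> mA; rewrite gauss_pdfE.
by apply: integrableS (@integrable_normal_pdf R 0 1) => //; exact: subsetT.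
Qed.

Lemma gauss_cdf_int x :
  gauss_cdf x = \int[lebesgue_measure]_(t in `]-oo, x]) gauss_pdf t.
Proof.
rewrite /gauss_cdf -RintegralZl//.
have /integrableZl-/(_ (measurable_itv _) (Num.sqrt (2 * pi))) :=
  @integrable_gauss_pdf `]-oo, x] (measurable_itv _).
apply: eq_integrable => // t _ /=.
by rewrite -EFinM /gauss_pdf mulrA mulfV ?mul1r// gt_eqF ?sqrt2pi_gt0.
Qed.

(** The identity as a random variable under the standard normal law: its [cdf] is [gauss_cdf],
    whence the limits at both infinities and the bounds 0 and 1. *)
Let idTR : measurableTypeR R -> R := idfun.

#[local] HB.instance Definition _ :=
  @isMeasurableFun.Build _ _ _ _ idTR (@measurable_id _ _ setT).

Lemma gauss_cdfE x : gauss_cdf x =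
  fine (cdf (idTR : {RV (normal_prob (0:R) 1) >-> R}) x).
Proof.
rewrite gauss_cdf_int /Rintegral gauss_pdfE.
by [].
Qed.

Lemma continuous_gauss_pdf : continuous gauss_pdf.
Proof. by rewrite gauss_pdfE; apply: continuous_normal_pdf;
  exact: oner_neq0. Qed.

Global Instance is_derive_gauss_cdf x : is_derive x 1 gauss_cdf (gauss_pdf x).
Proof.
have -> : gauss_cdf =
    fun x => \int[lebesgue_measure]_(t in `]-oo, x]) gauss_pdf t.
  by apply/funext => y; exact: gauss_cdf_int.
have xu : x < x + 1 by rewrite ltrDl.
have [] := @continuous_FTC1 _ gauss_pdf -oo%O x (x + 1) xu.
- exact: integrable_gauss_pdf.
- by rewrite ltNyr.
- exact: continuous_gauss_pdf.
by move=> dv <-; rewrite derive1E; exact: derivableP.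
Qed.

Lemma cvg_gauss_cdfy : gauss_cdf x @[x --> +oo] --> (1 : R).
Proof.
rewrite (_ : gauss_cdf = fine \o cdf (idTR : {RV (normal_prob (0:R) 1) >-> R})).
  apply: fine_cvg; exact: cvg_cdfy1.
by apply/funext => y; exact: gauss_cdfE.
Qed.

Lemma cvg_gauss_cdfNy : gauss_cdf x @[x --> -oo] --> (0 : R).
Proof.
rewrite (_ : gauss_cdf = fine \o cdf (idTR : {RV (normal_prob (0:R) 1) >-> R})).
  apply: fine_cvg; exact: cvg_cdfNy0.
by apply/funext => y; exact: gauss_cdfE.
Qed.

Lemma gauss_cdf_ndecr x y : x <= y -> gauss_cdf x <= gauss_cdf y.
Proof.
move=> xy; apply: (@ndecr_except _ _ gauss_pdf [::]) => //.
  exact: is_derive_continuous is_derive_gauss_cdf.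
by move=> z _ _; split; [exact: is_derive_gauss_cdf|exact/ltW/gauss_pdf_gt0].
Qed.

(** The slope is the peak of the density. Over the width of a ramp this is the smoothing error. *)
Lemma gauss_cdf_lip x y : x <= y ->
  gauss_cdf y - gauss_cdf x <= (y - x) / Num.sqrt (2 * pi).
Proof.
move=> xy.
pose F z : R := z * (Num.sqrt (2 * pi))^-1 - gauss_cdf z.
have dF z : is_derive z 1 F ((Num.sqrt (2 * pi))^-1 - gauss_pdf z).
  rewrite /F; apply: is_derive_eq.
  by rewrite !scaler0 ?addr0 ?add0r /GRing.scale/=; ring.
have : F x <= F y.
  apply: (@ndecr_except _ _
    (fun z => (Num.sqrt (2 * pi))^-1 - gauss_pdf z) [::]) => //.
    exact: is_derive_continuous dF.
  by move=> z _ _; split; [exact: dF|rewrite subr_ge0 gauss_pdf_le].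
by rewrite /F; lra.
Qed.

Lemma gauss_cdf_ge0 x : 0 <= gauss_cdf x.
Proof. by rewrite gauss_cdfE fine_ge0// cdf_ge0. Qed.

Lemma gauss_cdf_le1 x : gauss_cdf x <= 1.
Proof.
rewrite gauss_cdfE -[leRHS]/(fine 1%E); apply: fine_le => //.
- exact: fin_num_measure.
- exact: cdf_le1.
Qed.

Lemma gauss_pdfN x : gauss_pdf (- x) = gauss_pdf x.
Proof. by rewrite /gauss_pdf sqrrN. Qed.

Section Mills.
Variable T : R -> R.
Hypothesis dT : forall x, is_derive x 1 T (gauss_pdf x).
Hypothesis T_ge0 : forall x, 0 <= T x.
Hypothesis T_Ny : forall e, 0 < e -> exists M, forall y, y <= M -> T y <= e.

(* The derivative of [T x + x * gauss_pdf x / (1 + x ^+ 2)] is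
   [2 * gauss_pdf x / (1 + x ^+ 2) ^+ 2]. *)
Lemma mills_lower x : 0 <= (1 + x ^+ 2) * T x + x * gauss_pdf x.
Proof.
have p0 z : 0 < 1 + z ^+ 2 by rewrite ltr_pwDl// sqr_ge0.
pose F z := T z + z * gauss_pdf z * (1 + z ^+ 2)^-1.
pose dF z := gauss_pdf z * (2 * ((1 + z ^+ 2)^-1) ^+ 2).
have F' z : is_derive z 1 F (dF z).
  have z0 : 1 + z ^+ 2 != 0 by rewrite gt_eqF.
  have dp : is_derive z 1 (fun z => 1 + z ^+ 2 : R) (2 * z).
    by apply: is_derive_eq; rewrite /GRing.scale/=; ring.
  have dV := @is_deriveV R (fun z => 1 + z ^+ 2) z (2 * z) 1 z0 dp.
  rewrite /F /dF; apply: is_derive_eq.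
  rewrite /GRing.scale/=.
  by field.
have Fmono y : y <= x -> F y <= F x.
  move=> yx; apply: (@ndecr_except _ _ dF [::]) => //.
    exact: is_derive_continuous F'.
  move=> z _ _; split; first exact: F'.
  by apply: mulr_ge0; [exact/ltW/gauss_pdf_gt0|apply: mulr_ge0 => //;
    exact: sqr_ge0].
have -> : (1 + x ^+ 2) * T x + x * gauss_pdf x = (1 + x ^+ 2) * F x.
  by rewrite /F; have := p0 x; move=> /gt_eqF/negbT h; field.
apply: mulr_ge0; first exact/ltW/p0.
rewrite leNgt; apply/negP => Fx0.
pose C : R := (Num.sqrt (2 * pi))^-1.
have C0 : 0 < C by rewrite invr_gt0 sqrt2pi_gt0.
(* Far to the left [y * gauss_pdf y / (1 + y ^+ 2)] is at most of order [C / |y|] in size, hence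
   above the negative constant [F x]; this [y] is far enough to contradict [F y <= F x]. *)
pose y := Num.min x (- (C / (- F x) + 1)).
have yx : y <= x by rewrite ge_min lexx.
have y1 : y <= - (C / (- F x) + 1) by rewrite ge_min lexx orbT.
have Fx0' : 0 < - F x by rewrite oppr_gt0.
have yn : C + (- F x) <= - y * (- F x).
  rewrite -ler_pdivrMr// mulrDl mulfV ?gt_eqF//.
  by rewrite lerNr.
have := Fmono _ yx; rewrite /F -/(F x) => Fy.
have := T_ge0 y => Ty.
have yp : y * gauss_pdf y / (1 + y ^+ 2) <= F x by lra.
move: yp; rewrite ler_pdivrMr// => yp.
have := gauss_pdf_le y; rewrite -/C => pC.
have y0 : y < 0.
  by apply: le_lt_trans y1 _; rewrite oppr_lt0 addr_gt0// divr_gt0.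
have : - F x * (1 + y ^+ 2) <= - y * C.
  have : - y * gauss_pdf y <= - y * C by rewrite ler_wpM2l// oppr_ge0 ltW.
  lra.
have : - y * (C + - F x) <= - y * (- y * (- F x)).
  by rewrite ler_wpM2l// oppr_ge0 ltW.
have : 0 < - y * - F x by rewrite mulr_gt0// oppr_gt0.
nra.
Qed.

(* For negative x, [T x + gauss_pdf x / x] decreases from its limit 0 at -oo. *)
Lemma mills_upper x : 0 <= gauss_pdf x + x * T x.
Proof.
have [x0|x0] := leP 0 x.
  by rewrite addr_ge0 ?mulr_ge0// ltW// gauss_pdf_gt0.
pose F z := - (T z + gauss_pdf z * z^-1).
pose dF z := gauss_pdf z * (z ^-1) ^+ 2.
have xF y : y <= x -> F y <= F x.
  move=> yx.
  have F' z : z <= x -> is_derive z 1 F (dF z).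
    move=> zx.
    have z0 : z != 0 by rewrite lt_eqF// (le_lt_trans zx).
    have dV := @is_deriveV R (fun z => z) z 1 1 z0 (is_derive_id z 1).
    rewrite /F /dF; apply: is_derive_eq.
    rewrite /GRing.scale/=.
    by field.
  move: yx; rewrite le_eqVlt => /orP[/eqP ->//|yx].
  have [||c /[!in_itv]/= /andP[_ cx] E] := @MVT R F dF y x yx.
  - by move=> z /[!in_itv]/= /andP[_ /ltW zx]; exact: F'.
  - apply: derivable_within_continuous => z /[!in_itv]/= /andP[_ zx].
    by have [] := F' z zx.
  rewrite -subr_ge0 E mulr_ge0 ?subr_ge0 ?(ltW yx)// /dF mulr_ge0 ?sqr_ge0//.
  exact/ltW/gauss_pdf_gt0.
have -> : gauss_pdf x + x * T x = (- x) * F x.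
  by rewrite /F; have := lt_eqF x0; move=> /negbT h; field.
apply: mulr_ge0; first by rewrite oppr_ge0 ltW.
rewrite leNgt; apply/negP => Fx0.
(* If [F x < 0], then [T y >= - F x] for every [y <= x], which the decay of [T] at -oo forbids. *)
have [|M MP] := @T_Ny (- F x / 2); first by rewrite divr_gt0// oppr_gt0.
pose y := Num.min x M.
have yx : y <= x by rewrite ge_min lexx.
have yM : y <= M by rewrite ge_min lexx orbT.
have y0 : y < 0 by exact: le_lt_trans yx _.
have := xF y yx; rewrite {1}/F.
have : gauss_pdf y * y^-1 <= 0.
  by rewrite mulr_ge0_le0 ?invr_le0 ?(ltW y0)// ltW// gauss_pdf_gt0.
have := MP y yM.
lra.
Qed.

End Mills.

Lemma gauss_cdf_Ny e : 0 < e -> exists M, forall y, y <= M -> gauss_cdf y <= e.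
Proof.
move=> e0; have /cvgrPdist_le/(_ e e0) := cvg_gauss_cdfNy.
move=> [M [_ MP]]; exists (M - 1) => y yM.
have := MP y; rewrite sub0r normrN ger0_norm ?gauss_cdf_ge0//; apply.
by rewrite (le_lt_trans yM)// ltrBlDr ltrDl.
Qed.

(* The upper tail at [- x]: like [gauss_cdf], a primitive of [gauss_pdf]
   vanishing at -oo, so that the bounds above apply to both tails. *)
Definition gauss_ccdfN x : R := 1 - gauss_cdf (- x).

Lemma is_derive_gauss_ccdfN x : is_derive x 1 gauss_ccdfN (gauss_pdf x).
Proof.
have := @is_derive1_comp R gauss_cdf (fun z => - z) x _ _
   (is_derive_gauss_cdf _) (is_deriveN (is_derive_id x 1)).
move=> h; rewrite /gauss_ccdfN; apply: is_derive_eq.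
by rewrite gauss_pdfN; ring.
Qed.

Lemma gauss_ccdfN_Ny e :
  0 < e -> exists M, forall y, y <= M -> gauss_ccdfN y <= e.
Proof.
move=> e0; have /cvgrPdist_le/(_ e e0) := cvg_gauss_cdfy.
move=> [M [_ MP]]; exists (- M - 1) => y yM.
rewrite /gauss_ccdfN.
have := MP (- y); rewrite ger0_norm ?subr_ge0 ?gauss_cdf_le1//; apply.
by lra.
Qed.

Lemma gauss_ccdfN_ge0 x : 0 <= gauss_ccdfN x.
Proof. by rewrite subr_ge0 gauss_cdf_le1. Qed.

(* [gauss_K x] is the integral of [gauss_cdf] over ]-oo, x] and [gauss_J x] that
   of [1 - gauss_cdf] over [x, +oo[. *)
Definition gauss_K x := gauss_pdf x + x * gauss_cdf x.
Definition gauss_J x := gauss_pdf x - x * (1 - gauss_cdf x).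

Lemma gauss_K_ge0 x : 0 <= gauss_K x.
Proof.
exact: (mills_upper is_derive_gauss_cdf gauss_cdf_ge0 gauss_cdf_Ny).
Qed.

Lemma gauss_J_ge0 x : 0 <= gauss_J x.
Proof.
have := mills_upper is_derive_gauss_ccdfN gauss_ccdfN_ge0 gauss_ccdfN_Ny (- x).
by rewrite /gauss_ccdfN /gauss_J opprK gauss_pdfN mulNr.
Qed.

(** Divided by the density, this and [gauss_j_ge0] give the signs of the two brackets in
    [stein'']. *)
Lemma gauss_k_ge0 x : 0 <= (1 + x ^+ 2) * gauss_cdf x + x * gauss_pdf x.
Proof. exact: (mills_lower is_derive_gauss_cdf gauss_cdf_ge0). Qed.

Lemma gauss_j_ge0 x : 0 <= (1 + x ^+ 2) * (1 - gauss_cdf x) - x * gauss_pdf x.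
Proof.
have := mills_lower is_derive_gauss_ccdfN gauss_ccdfN_ge0 (- x).
by rewrite /gauss_ccdfN sqrrN opprK gauss_pdfN mulNr.
Qed.

Global Instance is_derive_gauss_K x : is_derive x 1 gauss_K (gauss_cdf x).
Proof.
by rewrite /gauss_K; apply: is_derive_eq; rewrite /GRing.scale/=; ring.
Qed.

Global Instance is_derive_gauss_J x : is_derive x 1 gauss_J (-
  (1 - gauss_cdf x)).
Proof.
by rewrite /gauss_J; apply: is_derive_eq; rewrite /GRing.scale/=; ring.
Qed.

End Gauss.

(** * Stein's equation for a ramp function *)

Section SteinRamp.
Variables (R : realType) (b c : R).
Hypothesis bc : b < c.
Implicit Types (x y z w : R).

Let Phi : R -> R := @gauss_cdf R.
Let phi : R -> R := @gauss_pdf R.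
Let J : R -> R := @gauss_J R.
Let K : R -> R := @gauss_K R.
Let d := c - b.

Let d0 : 0 < d. Proof. by rewrite subr_gt0. Qed.
Let dn0 : d != 0. Proof. by rewrite gt_eqF. Qed.

Lemma gauss_KE w : gauss_K w = gauss_J w + w.
Proof. by rewrite /gauss_K /gauss_J; ring. Qed.

Let KE w : K w = J w + w. Proof. exact: gauss_KE. Qed.

Lemma gauss_J_bounds x y : x <= y ->
  (y - x) * (1 - Phi y) <= J x - J y <= (y - x) * (1 - Phi x).
Proof.
move=> xy.
have [|z /[!in_itv]/= /andP[xz zy] E] :=
    @MVT_segment R J (fun z => - (1 - Phi z)) x y xy _.
  by apply: continuous_subspaceT;
    exact: is_derive_continuous (@is_derive_gauss_J R).
have -> : J x - J y = (y - x) * (1 - Phi z) by lra.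
by rewrite !ler_wpM2l ?subr_ge0// lerB// gauss_cdf_ndecr.
Qed.

Definition clip w := Num.min (Num.max w b) c.

Lemma clip_l w : w <= b -> clip w = b.
Proof. by move=> wb; rewrite /clip (max_idPr wb) (min_idPl (ltW bc)). Qed.
Lemma clip_m w : b <= w <= c -> clip w = w.
Proof. by move=> /andP[bw wc]; rewrite /clip (max_idPl bw) (min_idPl wc). Qed.
Lemma clip_r w : c <= w -> clip w = c.
Proof.
by move=> cw; rewrite /clip (max_idPl (le_trans (ltW bc) cw)) (min_idPr cw).
Qed.

Lemma continuous_clip : continuous clip.
Proof.
move=> x; rewrite /clip.
apply: (@continuous_min R R (fun w => Num.max w b) (fun=> c)).
  by apply: (@continuous_max R R id (fun=> b)) => //; exact: cvg_cst.
exact: cvg_cst.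
Qed.

(* [ramp] is 1 before [b], 0 after [c] and affine in between, see [rampE]; its
   Gaussian mean is [ramp_p].  [ramp_A w] is the integral of [- ramp' * Phi]
     over
   ]-oo, w] and [ramp_B w] that of [- ramp' * (1 - Phi)] over [w, +oo[. *)
Definition ramp_A w := (K (clip w) - K b) / d.
Definition ramp_B w := (J (clip w) - J c) / d.
Definition ramp_p := 1 - (J b - J c) / d.
Definition ramp w := ramp_B w - ramp_A w + ramp_p.
(** For t uniform in [b, c], [ramp] is the mean of the indicators of ]-oo, t]. Accordingly [stein]
    is the mean of their Stein solutions, which are [Phi w * (1 - Phi t) / phi w] for w <= t and
    [Phi t * (1 - Phi w) / phi w] for t <= w. *)
Definition stein w :=
  ((1 - Phi w) * ramp_A w + Phi w * ramp_B w) * (phi w)^-1.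
(** Read off Stein's equation, so that it is defined and continuous everywhere; [is_derive_stein]
    identifies it with the derivative off [b] and [c]. *)
Definition stein' w := w * stein w + ramp_B w - ramp_A w.

Let phi0 w : phi w != 0. Proof. by rewrite gt_eqF ?gauss_pdf_gt0. Qed.
Let Phi_ge0 w : 0 <= Phi w. Proof. exact: gauss_cdf_ge0. Qed.
Let Phi_le1 w : Phi w <= 1. Proof. exact: gauss_cdf_le1. Qed.
Let J_ge0 w : 0 <= J w. Proof. exact: gauss_J_ge0. Qed.
Let K_ge0 w : 0 <= K w. Proof. exact: gauss_K_ge0. Qed.

Variant clip_spec w : R -> Prop :=
| ClipL of w <= b : clip_spec w b
| ClipM of b <= w & w <= c : clip_spec w w
| ClipR of c <= w : clip_spec w c.

Lemma clipP w : clip_spec w (clip w).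
Proof.
have [wb|/ltW bw] := leP w b; first by rewrite clip_l//; constructor.
have [wc|/ltW cw] := leP w c; first by rewrite clip_m ?bw//; constructor.
by rewrite clip_r//; constructor.
Qed.

(** [ramp_A w * d] is the integral of [Phi] over a part of ]-oo, w] of length at most [d]. The bound
    by [K w] serves for the second derivative of [stein], the bound by [Phi w] for the first. *)
Lemma ramp_A_bounds w :
  [/\ 0 <= ramp_A w, ramp_A w * d <= K w & ramp_A w <= Phi w].
Proof.
rewrite /ramp_A divfK ?gt_eqF// ler_pdivrMr//.
have H x y : x <= y -> 0 <= K y - K x <= (y - x) * Phi y.
  move=> xy; have := gauss_J_bounds xy; rewrite !KE.
  have := ler_wpM2l (_ : 0 <= y - x) (Phi_le1 x); rewrite subr_ge0.
  have := ler_wpM2l (_ : 0 <= y - x) (Phi_ge0 x); rewrite subr_ge0.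
  by move=> /(_ xy) h1 /(_ xy) h2; lra.
have [wb|bw wc|cw] := clipP w.
- by rewrite subrr mul0r; split => //; rewrite mulr_ge0// ltW.
- have /andP[h1 h2] := H _ _ bw; split.
  + by rewrite divr_ge0// ltW.
  + by have := K_ge0 b; lra.
  + apply: (le_trans h2); rewrite mulrC ler_wpM2l//; rewrite /d; lra.
- have /andP[h1 h2] := H _ _ (ltW bc); split.
  + by rewrite divr_ge0// ltW.
  + by have := K_ge0 b; have /andP[h3 _] := H _ _ cw; lra.
  + by apply: (le_trans h2);
    rewrite mulrC ler_wpM2r ?(ltW d0)// gauss_cdf_ndecr.
Qed.

Lemma ramp_B_bounds w :
  [/\ 0 <= ramp_B w, ramp_B w * d <= J w & ramp_B w <= 1 - Phi w].
Proof.
rewrite /ramp_B divfK ?gt_eqF// ler_pdivrMr//.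
have H x y : x <= y -> 0 <= J x - J y <= (y - x) * (1 - Phi x).
  move=> xy; have /andP[h1 ->] := gauss_J_bounds xy; rewrite andbT.
  by apply: le_trans h1; rewrite mulr_ge0// subr_ge0.
have [wb|bw wc|cw] := clipP w.
- have /andP[h1 h2] := H _ _ (ltW bc); split.
  + by rewrite divr_ge0// ltW.
  + by have := J_ge0 c; have /andP[h3 _] := H _ _ wb; lra.
  + apply: (le_trans h2); rewrite mulrC ler_wpM2r ?(ltW d0)//.
    by rewrite lerB// gauss_cdf_ndecr.
- have /andP[h1 h2] := H _ _ wc; split.
  + by rewrite divr_ge0// ltW.
  + by have := J_ge0 c; lra.
  + apply: (le_trans h2); rewrite mulrC ler_wpM2l ?subr_ge0//; rewrite /d; lra.
- by rewrite subrr mul0r; split => //; rewrite mulr_ge0 ?subr_ge0// ltW.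
Qed.

Lemma rampE w : ramp w = (c - clip w) / d.
Proof.
rewrite /ramp /ramp_B /ramp_A /ramp_p !KE.
have : d != 0 by rewrite gt_eqF.
by rewrite /d => h; field; rewrite ?h.
Qed.

Lemma ramp_ge0 w : 0 <= ramp w.
Proof.
rewrite rampE divr_ge0 ?(ltW d0)// subr_ge0.
by case: clipP => // _; exact: ltW.
Qed.

Lemma ramp_le1 w : ramp w <= 1.
Proof.
rewrite rampE ler_pdivrMr// mul1r /d lerB//.
by case: clipP => // _; exact: ltW.
Qed.

Lemma ramp_l w : w <= b -> ramp w = 1.
Proof. by move=> wb; rewrite rampE clip_l// mulfV// gt_eqF. Qed.

Lemma ramp_r w : c <= w -> ramp w = 0.
Proof. by move=> wb; rewrite rampE clip_r// subrr mul0r. Qed.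

(** [ramp_p] is the average of [Phi] over [b, c]. *)
Lemma ramp_p_bounds : Phi b <= ramp_p <= Phi c.
Proof.
have /andP[h1 h2] := gauss_J_bounds (ltW bc).
rewrite /ramp_p.
have : (J b - J c) / d <= 1 - Phi b by rewrite ler_pdivrMr// mulrC.
have : 1 - Phi c <= (J b - J c) / d by rewrite ler_pdivlMr// mulrC.
by move=> *; lra.
Qed.

Lemma stein_eq w : ramp w - ramp_p = stein' w - w * stein w.
Proof. by rewrite /ramp /stein'; ring. Qed.

Let cJ : continuous J.
Proof. exact: is_derive_continuous (@is_derive_gauss_J R). Qed.
Let cK : continuous K.
Proof. exact: is_derive_continuous (@is_derive_gauss_K R). Qed.
Let cPhi : continuous Phi.
Proof. exact: is_derive_continuous (@is_derive_gauss_cdf R). Qed.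
Let cphi : continuous phi.
Proof. exact: continuous_gauss_pdf. Qed.

Lemma continuous_ramp_A : continuous ramp_A.
Proof.
move=> x; apply: cvgM; last exact: cvg_cst.
apply: cvgB; last exact: cvg_cst.
by apply: (@continuous_comp _ _ _ clip K); [exact: continuous_clip|exact: cK].
Qed.

Lemma continuous_ramp_B : continuous ramp_B.
Proof.
move=> x; apply: cvgM; last exact: cvg_cst.
apply: cvgB; last exact: cvg_cst.
by apply: (@continuous_comp _ _ _ clip J); [exact: continuous_clip|exact: cJ].
Qed.

Lemma continuous_ramp : continuous ramp.
Proof.
move=> x; apply: cvgD; last exact: cvg_cst.
by apply: cvgB; [exact: continuous_ramp_B|exact: continuous_ramp_A].
Qed.

Lemma continuous_stein : continuous stein.
Proof.
move=> x; apply: cvgM; last by apply: cvgV => //; exact: cphi.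
apply: cvgD; apply: cvgM.
- by apply: cvgB; [exact: cvg_cst|exact: cPhi].
- exact: continuous_ramp_A.
- exact: cPhi.
- exact: continuous_ramp_B.
Qed.

Lemma continuous_stein' : continuous stein'.
Proof.
move=> x; apply: cvgB; last exact: continuous_ramp_A.
apply: cvgD; last exact: continuous_ramp_B.
by apply: cvgM; [exact: cvg_id|exact: continuous_stein].
Qed.

(* The value 0 at [b] and [c], where [clip] has no derivative, is arbitrary. *)
Definition clip' w : R := if b < w < c then 1 else 0.

Lemma is_derive_clip w : w \notin [:: b; c] -> is_derive w 1 clip (clip' w).
Proof.
rewrite !inE negb_or => /andP[wb wc].
have near_derive (g : R -> R) dg : is_derive w 1 g dg ->
    (\forall x \near w, g x = clip x) -> is_derive w 1 clip dg.
  by move=> dgw H; exact: near_eq_is_derive dgw.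
rewrite /clip'; have [wb'|wb'|/eqP] := ltgtP w b; last by rewrite (negbTE wb).
- apply: (near_derive (cst b)).
  have /near_in_itvNyo : w \in `]-oo, b[ by rewrite in_itv.
  by apply: filterS => x /[!inE]/= xb; rewrite clip_l// ltW.
- have [wc'|wc'|/eqP] := ltgtP w c; last by rewrite (negbTE wc).
    apply: (near_derive id).
    have /near_in_itvoo : w \in `]b, c[ by rewrite in_itv/= wb'.
    by apply: filterS => x /[!inE]/= /andP[/ltW bx /ltW xc];
      rewrite clip_m// bx.
  apply: (near_derive (cst c)).
  have /near_in_itvoy : w \in `]c, +oo[ by rewrite in_itv/= wc'.
  by apply: filterS => x /[!inE]/= /andP[/ltW cx _]; rewrite clip_r.
Qed.

Let clip'_ge0 w : 0 <= clip' w. Proof. by rewrite /clip'; case: ifP. Qed.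
Let clip'_le1 w : clip' w <= 1. Proof. by rewrite /clip'; case: ifP. Qed.

(** The factor [g' w] may stand for [g' (clip w)]: where [clip'] is not 0, [clip w = w]. *)
Lemma is_derive_comp_clip (g g' : R -> R) w : w \notin [:: b; c] ->
  (forall x, is_derive x 1 g (g' x)) ->
  is_derive w 1 (g \o clip) (g' w * clip' w).
Proof.
move=> wbc dg; have dc := is_derive_clip wbc.
apply: is_derive_eq; rewrite /clip'; case: ifP => [/andP[bw cw]|_].
  by rewrite clip_m ?ltW.
by rewrite !mulr0.
Qed.

Lemma is_derive_ramp_A w : w \notin [:: b; c] ->
  is_derive w 1 ramp_A (clip' w / d * Phi w).
Proof.
move=> wbc; have h := is_derive_comp_clip wbc (@is_derive_gauss_K R).
rewrite /ramp_A; apply: is_derive_eq.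
by rewrite scaler0 add0r subr0 /GRing.scale/= -/(Phi w); ring.
Qed.

Lemma is_derive_ramp_B w : w \notin [:: b; c] ->
  is_derive w 1 ramp_B (- (clip' w / d * (1 - Phi w))).
Proof.
move=> wbc; have h := is_derive_comp_clip wbc (@is_derive_gauss_J R).
rewrite /ramp_B; apply: is_derive_eq.
by rewrite scaler0 add0r subr0 /GRing.scale/= -/(Phi w); ring.
Qed.

Lemma is_derive_stein w : w \notin [:: b; c] -> is_derive w 1 stein (stein' w).
Proof.
move=> wbc; have dA := is_derive_ramp_A wbc; have dB := is_derive_ramp_B wbc.
have dV := @is_deriveV R phi w _ 1 (phi0 w) (is_derive_gauss_pdf w).
rewrite /stein /stein' /stein; apply: is_derive_eq.
rewrite /GRing.scale/= -/(phi w) -/(Phi w).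
by field; rewrite ?phi0 ?dn0.
Qed.

(** The two brackets are the second derivatives of [(1 - Phi) / phi] and of [Phi / phi]. *)
Definition stein'' w := ramp_A w * ((1 + w ^+ 2) * (1 - Phi w) / phi w - w) +
  ramp_B w * ((1 + w ^+ 2) * Phi w / phi w + w) - clip' w / d.

Lemma is_derive_stein' w :
  w \notin [:: b; c] -> is_derive w 1 stein' (stein'' w).
Proof.
move=> wbc; have dA := is_derive_ramp_A wbc; have dB := is_derive_ramp_B wbc.
have df := is_derive_stein wbc.
rewrite /stein'; apply: is_derive_eq.
rewrite /GRing.scale/= /stein'' /stein' /stein.
by field; rewrite ?phi0 ?dn0.
Qed.

(* The two brackets in [stein''] are nonnegative and, weighted by [gauss_K w]
   and [gauss_J w], sum to 1. *)
Lemma stein''_le w : `|stein'' w| <= d^-1.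
Proof.
have [A0 AK _] := ramp_A_bounds w; have [B0 BJ _] := ramp_B_bounds w.
have pw : 0 < phi w by exact: gauss_pdf_gt0.
have kN : 0 <= (1 + w ^+ 2) * (1 - Phi w) / phi w - w.
  by rewrite subr_ge0 ler_pdivlMr// -subr_ge0; exact: gauss_j_ge0.
have kP : 0 <= (1 + w ^+ 2) * Phi w / phi w + w.
  rewrite -[w in X in _ + X]opprK subr_ge0 ler_pdivlMr// -subr_ge0 mulNr opprK.
  exact: gauss_k_ge0.
have e : ((1 + w ^+ 2) * (1 - Phi w) / phi w - w) * K w +
   ((1 + w ^+ 2) * Phi w / phi w + w) * J w = 1.
  rewrite /K /J /gauss_K /gauss_J -/(phi w) -/(Phi w).
  by field; rewrite ?phi0 ?dn0.
set kn := _ - w in kN e *; set kp := _ + w in kP e *.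
rewrite /stein'' -/kn -/kp.
have dV : 0 < d^-1 by rewrite invr_gt0.
(* The weighted sum of the brackets and [clip'] both lie in [0, 1], so their difference lies in
   [-1, 1]. *)
have -> : ramp_A w * kn + ramp_B w * kp - clip' w / d =
  (kn * (ramp_A w * d) + kp * (ramp_B w * d) - clip' w) / d.
  by have : d != 0 by [rewrite gt_eqF]; move=> h; field.
rewrite normrM [X in _ * X]gtr0_norm// ler_piMl ?(ltW dV)//.
have h1 : kn * (ramp_A w * d) <= kn * K w by rewrite ler_wpM2l.
have h2 : kp * (ramp_B w * d) <= kp * J w by rewrite ler_wpM2l.
have h3 : 0 <= kn * (ramp_A w * d) by exact: mulr_ge0 kN (mulr_ge0 A0 (ltW d0)).
have h4 : 0 <= kp * (ramp_B w * d) by exact: mulr_ge0 kP (mulr_ge0 B0 (ltW d0)).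
by rewrite ler_norml; have := clip'_ge0 w; have := clip'_le1 w; lra.
Qed.

(** [stein'] is a difference of two nonnegative terms, [ramp_B * K / phi] and [ramp_A * J / phi].
    Since [ramp_B <= 1 - Phi] and [ramp_A <= Phi], each is at most 1: the products [(1 - Phi) * K]
    and [Phi * J] are nonnegative with sum [phi]. *)
Lemma stein'_le1 w : `|stein' w| <= 1.
Proof.
have [A0 _ AP] := ramp_A_bounds w; have [B0 _ BP] := ramp_B_bounds w.
have pw : 0 < phi w by exact: gauss_pdf_gt0.
have -> : stein' w = (ramp_B w * K w - ramp_A w * J w) / phi w.
  rewrite /stein' /stein /K /J /gauss_K /gauss_J -/(phi w) -/(Phi w).
  by field; rewrite ?phi0 ?dn0.
have h1 : 0 <= ramp_B w * K w by exact: mulr_ge0 B0 (K_ge0 w).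
have h2 : 0 <= ramp_A w * J w by exact: mulr_ge0 A0 (J_ge0 w).
have h3 : ramp_B w * K w <= (1 - Phi w) * K w by rewrite ler_wpM2r.
have h4 : ramp_A w * J w <= Phi w * J w by rewrite ler_wpM2r.
have P0 := Phi_ge0 w; have P1 : 0 <= 1 - Phi w by rewrite subr_ge0.
have h5 : (1 - Phi w) * K w <= phi w.
  have [w0|w0] := leP 0 w.
    have := mulr_ge0 P0 (J_ge0 w); rewrite /J /gauss_J /K /gauss_K.
    rewrite -/(phi w) -/(Phi w); lra.
  have : 0 <= Phi w * phi w by exact: mulr_ge0 P0 (ltW pw).
  have : 0 <= (- w) * (Phi w * (1 - Phi w)).
    by apply: mulr_ge0; [rewrite oppr_ge0 ltW|exact: mulr_ge0].
  rewrite /K /gauss_K -/(phi w) -/(Phi w); lra.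
have h6 : Phi w * J w <= phi w.
  have [w0|w0] := leP w 0.
    have := mulr_ge0 P1 (K_ge0 w); rewrite /J /gauss_J /K /gauss_K.
    rewrite -/(phi w) -/(Phi w); lra.
  have : 0 <= (1 - Phi w) * phi w by exact: mulr_ge0 P1 (ltW pw).
  have : 0 <= w * (Phi w * (1 - Phi w)).
    by apply: mulr_ge0; [exact: ltW|exact: mulr_ge0].
  rewrite /J /gauss_J -/(phi w) -/(Phi w); lra.
rewrite normrM normfV [X in _ / X]gtr0_norm// ler_pdivrMr// mul1r.
by rewrite ler_norml; lra.
Qed.

Lemma stein'_lip x y : x <= y -> `|stein' y - stein' x| <= (y - x) / d.
Proof.
move=> xy.
have cst' (k : R) : continuous (fun z => z * k).
  by move=> z; apply: cvgM; [exact: cvg_id|exact: cvg_cst].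
rewrite ler_norml; apply/andP; split.
- have : stein' x + x * d^-1 <= stein' y + y * d^-1.
    apply: (@ndecr_except R (fun z => stein' z + z * d^-1)
             (fun z => stein'' z + d^-1) [:: b; c] x y _ xy).
      by move=> z; apply: cvgD; [exact: continuous_stein'|exact: cst'].
    move=> z _ zbc; split.
      have h := is_derive_stein' zbc; apply: is_derive_eq.
      by rewrite scaler0 add0r /GRing.scale/= mulr1.
    by have := stein''_le z; rewrite ler_norml => /andP[]; lra.
  by lra.
- have : x * d^-1 - stein' x <= y * d^-1 - stein' y.
    apply: (@ndecr_except R (fun z => z * d^-1 - stein' z)
             (fun z => d^-1 - stein'' z) [:: b; c] x y _ xy).
      by move=> z; apply: cvgB; [exact: cst'|exact: continuous_stein'].
    move=> z _ zbc; split.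
      have h := is_derive_stein' zbc; apply: is_derive_eq.
      by rewrite scaler0 add0r /GRing.scale/= mulr1.
    by have := stein''_le z; rewrite ler_norml => /andP[]; lra.
  by lra.
Qed.

(** The comparison function [F k] adds [k] times the claimed remainder to [stein] minus its linear
    part. As [stein'] is Lipschitz of constant [1 / d], [F 1] is minimal and [F (-1)] maximal at
    [x]. *)
Lemma stein_taylor x y :
  `|stein y - stein x - stein' x * (y - x)| <= (y - x) ^+ 2 / (2 * d).
Proof.
pose F k z := stein z - stein' x * z + k * ((z - x) ^+ 2 / (2 * d)).
pose F' k z := stein' z - stein' x + k * ((z - x) / d).
have cF k : continuous (F k).
  move=> z; apply: cvgD; first apply: cvgB.
  - exact: continuous_stein.
  - by apply: cvgM; [exact: cvg_cst|exact: cvg_id].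
  - apply: cvgM; first exact: cvg_cst.
    apply: cvgM; last exact: cvg_cst.
    by apply: cvgM; apply: cvgB; (exact: cvg_id || exact: cvg_cst).
have dF k z : z \notin [:: b; c] -> is_derive z 1 (F k) (F' k z).
  move=> zbc; have h := is_derive_stein zbc; rewrite /F; apply: is_derive_eq.
  by rewrite /F' /GRing.scale/=; field; rewrite ?dn0.
have cN k : continuous (fun z => - F k z) by move=> z; apply: cvgN; exact: cF.
have dN k z : z \notin [:: b; c] -> is_derive z 1 (fun z => - F k z) (- F' k z).
  by move=> zbc; have h := dF k z zbc; apply: is_derive_eq.
have Fx k : F k x = stein x - stein' x * x.
  by rewrite /F subrr expr0n mul0r mulr0 addr0.
have [] : F (-1) y <= F (-1) x /\ F 1 x <= F 1 y.
  have [xy|/ltW yx] := leP x y; split.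
  - rewrite -lerN2; apply: (@ndecr_except R (fun z => - F (-1) z)
    (fun z => - F' (-1) z) [:: b; c] x y (cN _) xy).
    move=> z /andP[xz _] zbc; split; first exact: dN.
    by have := stein'_lip (ltW xz); rewrite /F' ler_norml => /andP[]; lra.
  - apply: (@ndecr_except R (F 1) (F' 1) [:: b; c] x y (cF _) xy).
    move=> z /andP[xz _] zbc; split; first exact: dF.
    by have := stein'_lip (ltW xz); rewrite /F' ler_norml => /andP[]; lra.
  - apply: (@ndecr_except R (F (-1)) (F' (-1)) [:: b; c] y x (cF _) yx).
    move=> z /andP[_ xz] zbc; split; first exact: dF.
    by have := stein'_lip (ltW xz); rewrite /F' ler_norml => /andP[]; lra.
  - rewrite -lerN2; apply: (@ndecr_except R (fun z => - F 1 z)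
    (fun z => - F' 1 z) [:: b; c] y x (cN _) yx).
    move=> z /andP[_ xz] zbc; split; first exact: dN.
    by have := stein'_lip (ltW xz); rewrite /F' ler_norml => /andP[]; lra.
rewrite !Fx /F ler_norml => h1 h2; lra.
Qed.

End SteinRamp.

(** * Averaging over the group *)

Section HaarMean.
Variables (R : realType) (G : topologicalGroupType).
Variable mu : probability (borel G) R.
Hypothesis Gc : compact [set: G].
Hypothesis muL : haar mu.
Implicit Types (f : G -> R) (g h : G).

Definition haar_mean f : R := \int[mu]_x (f x).

Lemma continuous_mulgl g : continuous (fun x : G => (g * x)%g).
Proof.
move=> x; apply: (@continuous_comp _ _ _ (fun x : G => (g,
  x)) (fun p : G * G => (p.1 * p.2)%g)).
  by apply: cvg_pair; [exact: cvg_cst|exact: cvg_id].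
exact: mulg_continuous.
Qed.

Lemma continuous_borel f :
  continuous f -> measurable_fun [set: borel G] (f : borel G -> R).
Proof.
move=> /continuousP cf; apply: (measurability _ (@RGenOpens.measurableE R)).
move=> _ [_ [a [b ->] <-]]; rewrite setTI.
by apply: sub_sigma_algebra; exact/cf/interval_open.
Qed.

Lemma mean_integrable f : continuous f ->
  mu.-integrable [set: borel G] (EFin \o f).
Proof.
move=> cf; apply: measurable_bounded_integrable => //.
- by rewrite -ge0_fin_numE//; exact: fin_num_measure.
- exact: continuous_borel.
- have := continuous_compact (continuous_subspaceT cf) Gc.
  move=> /compact_bounded[M [Mr Mf]]; exists M; split => // x Mx y _.
  by apply: Mf => //; exists y.
Qed.

Lemma mean_cst (k : R) : haar_mean (fun=> k) = k.
Proof. by rewrite /haar_mean Rintegral_cst//= probability_setT mulr1. Qed.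

Lemma meanD f1 f2 : continuous f1 -> continuous f2 ->
  haar_mean (fun x => f1 x + f2 x) = haar_mean f1 + haar_mean f2.
Proof. by move=> c1 c2; rewrite /haar_mean RintegralD//;
  exact: mean_integrable. Qed.

Lemma meanB f1 f2 : continuous f1 -> continuous f2 ->
  haar_mean (fun x => f1 x - f2 x) = haar_mean f1 - haar_mean f2.
Proof. by move=> c1 c2; rewrite /haar_mean RintegralB//;
  exact: mean_integrable. Qed.

Lemma meanZ (k : R) f : continuous f ->
  haar_mean (fun x => k * f x) = k * haar_mean f.
Proof. by move=> cf; rewrite /haar_mean RintegralZl//;
  exact: mean_integrable. Qed.

Lemma meanZr (k : R) f : continuous f ->
  haar_mean (fun x => f x * k) = haar_mean f * k.
Proof.
by move=> cf; rewrite mulrC -meanZ//; congr haar_mean; apply/funext => x;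
  rewrite mulrC.
Qed.

Lemma mean_le f1 f2 : continuous f1 -> continuous f2 ->
  (forall x, f1 x <= f2 x) -> haar_mean f1 <= haar_mean f2.
Proof. by move=> c1 c2 h; apply: le_Rintegral => //;
  exact: mean_integrable. Qed.

(** By compactness [f] stays above a positive minimum. *)
Lemma mean_gt0 f : continuous f -> (forall x, 0 < f x) -> 0 < haar_mean f.
Proof.
move=> cf f0.
have [||c _ cP] := @compact_EVT_min G R f [set: G] _ Gc.
- by exists point.
- exact: continuous_subspaceT.
apply: (lt_le_trans (f0 c)); rewrite -[leLHS]mean_cst; apply: mean_le => //.
- by move=> x; exact: cvg_cst.
- by move=> x; apply: cP; rewrite inE.
Qed.

Lemma measurable_mulgl g : measurable_fun [set: borel G]
  (fun x : G => (g * x)%g : borel G).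
Proof.
apply: (@measurability _ _ (borel G) (borel G) _ _ (@open G)) => //.
move=> _ [A oA <-]; rewrite setTI; apply: sub_sigma_algebra.
by have /continuousP := @continuous_mulgl g; apply.
Qed.

Lemma mean_mulgl g f : continuous f ->
  haar_mean (fun x => f (g * x)%g) = haar_mean f.
Proof.
move=> cf; rewrite /haar_mean /Rintegral; congr fine.
have cg : continuous (fun x => f (g * x)%g).
  by move=> x; apply: (@continuous_comp _ _ _ (fun x => (g * x)%g) f);
    [exact: continuous_mulgl|exact: cf].
have mf := (measurable_EFinP _ _).2 (continuous_borel cf).
have := integral_pushforward (measurable_mulgl g) mf
  (mean_integrable cg) measurableT.
rewrite preimage_setT => <-.
apply: eq_measure_integral; first exact: measurable_mulgl.
(* Translating by [g] the preimage of [A] under the translation by [g] gives back [A]. *)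
move=> mg A mA _; rewrite /= /pushforward /= -(muL g); last first.
  by rewrite -[X in measurable X]setTI; exact: (measurable_mulgl g).
congr (mu _); apply/seteqP; split => [x [y] /= Ay <-//|x Ax].
by exists (g^-1 * x)%g => /=; rewrite mulVKg.
Qed.

Lemma measurable_le f (x0 : R) : continuous f ->
  measurable ([set g | f g <= x0] : set (borel G)).
Proof.
move=> cf; have := @continuous_borel f cf measurableT _ (measurable_itv `]-oo,
  x0]).
by rewrite setTI; congr measurable; apply/seteqP; split=> x /=; rewrite in_itv.
Qed.

Lemma mean_indic f (x0 : R) : continuous f ->
  fine (mu [set g | f g <= x0]) = haar_mean (\1_[set g | f g <= x0]).
Proof.
by move=> cf; rewrite /haar_mean /Rintegral integral_indic ?setIT//;
  exact: measurable_le.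
Qed.

(** Meant for the ramp whose descent starts at [x0]; the converse [mean_le_prob] is for the one
    whose descent ends there. *)
Lemma prob_le_mean f (u : G -> R) (x0 : R) : continuous f -> continuous u ->
  (forall x, 0 <= u x) -> (forall x, f x <= x0 -> 1 <= u x) ->
  fine (mu [set g | f g <= x0]) <= haar_mean u.
Proof.
move=> cf cu u0 u1; rewrite mean_indic//; apply: le_Rintegral => //.
- by apply: integrable_indic; exact: measurable_le.
- exact: mean_integrable.
- move=> x _; rewrite indicE; case: (boolP (x \in _)) => [|_]; last exact: u0.
  by rewrite inE; exact: u1.
Qed.

Lemma mean_le_prob f (u : G -> R) (x0 : R) : continuous f -> continuous u ->
  (forall x, u x <= 1) -> (forall x, x0 <= f x -> u x <= 0) ->
  haar_mean u <= fine (mu [set g | f g <= x0]).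
Proof.
move=> cf cu u0 u1; rewrite mean_indic//; apply: le_Rintegral => //.
- exact: mean_integrable.
- by apply: integrable_indic; exact: measurable_le.
- move=> x _; rewrite indicE; case: (boolP (x \in _)) => //;
  rewrite notin_setE/= => /negP.
  by rewrite -ltNge => /ltW/u1.
Qed.

End HaarMean.

Lemma continuous_sum (K : numFieldType) (T : topologicalType) (I : Type)
    (s : seq I) (P : pred I) (F : I -> T -> K) :
  (forall i, continuous (F i : T -> K^o)) ->
  continuous (fun x => \sum_(i <- s | P i) F i x : K^o).
Proof.
move=> cF; elim: s => [|i s IH].
  by under eq_fun do rewrite big_nil; exact: cst_continuous.
under eq_fun do rewrite big_cons.
by case: (P i) => // x; apply: cvgD; [exact: cF|exact: IH].
Qed.

(** * Means of complex-valued functions *)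

Section ComplexContinuity.
Variables (R : realType) (T : topologicalType).
Local Notation C := R[i].
Implicit Types (F : T -> C) (f : T -> R).

Definition ccont F := continuous (F : T -> C^o).

Lemma normr_Re_le (z : C) : (`|complex.Re z|)%:C%C <= `|z|.
Proof.
rewrite normc_def lecR -sqrtr_sqr; apply: ler_wsqrtr.
by rewrite lerDl sqr_ge0.
Qed.

Lemma normr_Im_le (z : C) : (`|complex.Im z|)%:C%C <= `|z|.
Proof.
rewrite normc_def lecR -sqrtr_sqr; apply: ler_wsqrtr.
by rewrite lerDr sqr_ge0.
Qed.

Lemma ccont_Re F : ccont F -> continuous (fun x => complex.Re (F x)).
Proof.
move=> cF x; apply/cvgrPdist_lt => e e0.
have /cvgrPdist_lt/(_ e%:C%C) := cF x; rewrite ltcR => /(_ e0).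
apply: filterS => y h; rewrite -ltcR -raddfB/=.
exact: le_lt_trans (normr_Re_le _) h.
Qed.

Lemma ccont_Im F : ccont F -> continuous (fun x => complex.Im (F x)).
Proof.
move=> cF x; apply/cvgrPdist_lt => e e0.
have /cvgrPdist_lt/(_ e%:C%C) := cF x; rewrite ltcR => /(_ e0).
apply: filterS => y h; rewrite -ltcR -raddfB/=.
exact: le_lt_trans (normr_Im_le _) h.
Qed.

Lemma ccont_cst (z : C) : ccont (fun=> z).
Proof. by move=> x; exact: cvg_cst. Qed.

Lemma ccontD F1 F2 : ccont F1 -> ccont F2 -> ccont (fun x => F1 x + F2 x).
Proof. by move=> c1 c2 x; apply: cvgD; [exact: c1|exact: c2]. Qed.

Lemma ccontM F1 F2 : ccont F1 -> ccont F2 -> ccont (fun x => F1 x * F2 x).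
Proof. exact: continuous_mul. Qed.

Lemma ccont_conj F : ccont F -> ccont (fun x => (F x)^*).
Proof. exact: continuous_conj. Qed.

Lemma ccont_sum (I : Type) (s : seq I) (P : pred I) (F : I -> T -> C) :
  (forall i, ccont (F i)) -> ccont (fun x => \sum_(i <- s | P i) F i x).
Proof. exact: continuous_sum. Qed.

End ComplexContinuity.

Section ComplexMean.
Variables (R : realType) (G : topologicalGroupType).
Variable mu : probability (borel G) R.
Hypothesis Gc : compact [set: G].
Hypothesis muL : haar mu.
Local Notation C := R[i].
Implicit Types (F : G -> C).

Definition haar_cmean F : C :=
  Complex (haar_mean mu (fun x => complex.Re (F x))) (haar_mean mu
    (fun x => complex.Im (F x))).

Lemma cmean_cst (z : C) : haar_cmean (fun=> z) = z.
Proof. by rewrite /haar_cmean !mean_cst; case: z. Qed.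

Lemma cmeanD F1 F2 : ccont F1 -> ccont F2 ->
  haar_cmean (fun x => F1 x + F2 x) = haar_cmean F1 + haar_cmean F2.
Proof.
move=> c1 c2; rewrite /haar_cmean; under eq_fun do rewrite raddfD/=.
rewrite meanD//; try exact: ccont_Re.
under [X in Complex _ (haar_mean _ X)]eq_fun do rewrite raddfD/=.
by rewrite meanD//; exact: ccont_Im.
Qed.

Lemma cmean_sum (I : Type) (s : seq I) (P : pred I) (F : I -> G -> C) :
  (forall i, ccont (F i)) ->
  haar_cmean (fun x => \sum_(i <- s | P i) F i x) =
    \sum_(i <- s | P i) haar_cmean (F i).
Proof.
move=> cF; elim: s => [|i s IH].
  by under eq_fun do rewrite big_nil; rewrite big_nil cmean_cst.
under eq_fun do rewrite big_cons; rewrite big_cons.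
by case: (P i) => //; rewrite cmeanD ?IH//; exact: ccont_sum.
Qed.

Lemma cmeanZ (z : C) F : ccont F ->
  haar_cmean (fun x => z * F x) = z * haar_cmean F.
Proof.
move=> cF; have cR := ccont_Re cF; have cI := ccont_Im cF.
have cont_scale (k : R) (f : G -> R) : continuous f ->
  continuous (fun x => k * f x).
  by move=> cf x; apply: cvgM; [exact: cvg_cst|exact: cf].
rewrite /haar_cmean; case: z => a b.
have -> : (fun x => complex.Re ((Complex a b) * F x)) =
    fun x => a * complex.Re (F x) - b * complex.Im (F x).
  by apply/funext => x; case: (F x).
have -> : (fun x => complex.Im ((Complex a b) * F x)) =
    fun x => a * complex.Im (F x) + b * complex.Re (F x).
  by apply/funext => x; case: (F x) => u v /=; rewrite [b * u]mulrC.
rewrite meanB ?meanD ?meanZ//; do ?exact: cont_scale.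
Qed.

Lemma cmeanZr (z : C) F : ccont F ->
  haar_cmean (fun x => F x * z) = haar_cmean F * z.
Proof.
move=> cF; under eq_fun do rewrite mulrC.
by rewrite cmeanZ// mulrC.
Qed.

Lemma cmean_conj F : ccont F ->
  haar_cmean (fun x => (F x)^*) = (haar_cmean F)^*.
Proof.
move=> cF; rewrite /haar_cmean.
have -> : (fun x => complex.Re ((F x)^*)) = fun x => complex.Re (F x).
  by apply/funext => x; case: (F x).
have -> : (fun x => complex.Im ((F x)^*)) = fun x => (-1) * complex.Im (F x).
  by apply/funext => x; case: (F x) => u v; rewrite mulN1r.
by rewrite meanZ ?mulN1r//; exact: ccont_Im.
Qed.

Lemma cmean_mulgl g F : ccont F ->
  haar_cmean (fun x => F (g * x)%g) = haar_cmean F.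
Proof.
move=> cF; rewrite /haar_cmean; congr Complex.
  exact: (mean_mulgl Gc muL g (ccont_Re cF)).
exact: (mean_mulgl Gc muL g (ccont_Im cF)).
Qed.

Lemma cmean_neq0 (f : G -> R) : continuous f -> (forall x, 0 < f x) ->
  haar_cmean (fun x => (f x)%:C%C) != 0.
Proof.
move=> cf f0; apply/eqP => -[/eqP + _]; apply/negP.
by rewrite gt_eqF// (mean_gt0 _ Gc).
Qed.

End ComplexMean.

(** * Representations *)

Section Averaging.
Variables (R : realType) (G : topologicalGroupType).
Variable mu : probability (borel G) R.
Hypothesis Gc : compact [set: G].
Hypothesis muL : haar mu.
Local Notation C := R[i].
Local Notation cmean := (haar_cmean mu).
Implicit Types (rho sigma phi psi : rep R G).

Definition mxmean m n (F : G -> 'M[C]_(m, n)) : 'M[C]_(m, n) :=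
  \matrix_(i, j) cmean (fun g => F g i j).

Lemma mx_continuous_cst m n (A : 'M[C]_(m, n)) :
  mx_continuous (fun _ : G => A).
Proof. by move=> i j; exact: cst_continuous. Qed.

Lemma mx_continuous_mul m n p (F1 : G -> 'M[C]_(m, n)) (F2 : G ->
  'M[C]_(n, p)) :
  mx_continuous F1 -> mx_continuous F2 ->
  mx_continuous (fun g => F1 g *m F2 g).
Proof.
move=> c1 c2 i j; under eq_fun do rewrite mxE.
by apply: ccont_sum => k; apply: ccontM; [exact: c1|exact: c2].
Qed.

Lemma mx_continuousV m n (F : G -> 'M[C]_(m, n)) :
  mx_continuous F -> mx_continuous (fun g => F (g^-1)%g).
Proof.
move=> cF i j x.
apply: (@continuous_comp _ _ _ (fun x : G => (x^-1)%g)
  (fun g => F g i j : C^o)).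
  exact: invg_continuous.
exact: cF.
Qed.

Lemma mx_continuous_adj m n (F : G -> 'M[C]_(m, n)) :
  mx_continuous F -> mx_continuous (fun g => (map_mx Num.conj (F g))^T).
Proof.
move=> cF i j; under eq_fun do rewrite !mxE.
exact: ccont_conj (cF j i).
Qed.

Lemma mxmean_mull m n p (A : 'M[C]_(p, m)) (F : G -> 'M[C]_(m, n)) :
  mx_continuous F -> mxmean (fun g => A *m F g) = A *m mxmean F.
Proof.
move=> cF; apply/matrixP => i j; rewrite !mxE; under eq_fun do rewrite mxE.
rewrite cmean_sum//; last by move=> k; apply: ccontM;
  [exact: ccont_cst|exact: cF].
by apply: eq_bigr => k _; rewrite cmeanZ ?mxE//; exact: cF.
Qed.

Lemma mxmean_mulr m n p (A : 'M[C]_(n, p)) (F : G -> 'M[C]_(m, n)) :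
  mx_continuous F -> mxmean (fun g => F g *m A) = mxmean F *m A.
Proof.
move=> cF; apply/matrixP => i j; rewrite !mxE; under eq_fun do rewrite mxE.
rewrite cmean_sum//; last by move=> k; apply: ccontM;
  [exact: cF|exact: ccont_cst].
by apply: eq_bigr => k _; rewrite cmeanZr ?mxE//; exact: cF.
Qed.

Lemma mxmean_mul2 m n p q (A : 'M[C]_(p, m)) (B : 'M[C]_(n, q))
    (F : G -> 'M[C]_(m, n)) : mx_continuous F ->
  mxmean (fun g => A *m F g *m B) = A *m mxmean F *m B.
Proof.
move=> cF; rewrite (mxmean_mulr B (F := fun g => A *m F g)) ?mxmean_mull//.
by apply: mx_continuous_mul cF; exact: mx_continuous_cst.
Qed.

Lemma mxmean_cst m n (A : 'M[C]_(m, n)) : mxmean (fun=> A) = A.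
Proof. by apply/matrixP => i j; rewrite mxE cmean_cst. Qed.

Lemma mxmean_mulgl m n g (F : G -> 'M[C]_(m, n)) : mx_continuous F ->
  mxmean (fun x => F (g * x)%g) = mxmean F.
Proof.
move=> cF; apply/matrixP => i j; rewrite !mxE.
exact: (cmean_mulgl Gc muL g (cF i j)).
Qed.

Lemma mxtrace_mean n (F : G -> 'M[C]_n) : mx_continuous F ->
  \tr (mxmean F) = cmean (fun g => \tr (F g)).
Proof.
move=> cF; rewrite /mxtrace cmean_sum//; last by move=> i; exact: cF.
by apply: eq_bigr => i _; rewrite mxE.
Qed.

Lemma rep_mulVr rho g : rho g *m rho (g^-1)%g = 1%:M.
Proof. by rewrite -rep_M mulgV rep_1. Qed.

Lemma rep_mulVl rho g : rho (g^-1)%g *m rho g = 1%:M.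
Proof. by rewrite -rep_M mulVg rep_1. Qed.

(** The projection of an arbitrary matrix onto the maps commuting with the two actions. *)
Definition intertwiner phi psi (X : 'M[C]_(rep_dim phi, rep_dim psi)) :=
  mxmean (fun g => phi g *m X *m psi (g^-1)%g).

Lemma intertwiner_continuous phi psi (X : 'M[C]_(rep_dim phi, rep_dim psi)) :
  mx_continuous (fun g => phi g *m X *m psi (g^-1)%g).
Proof.
apply: mx_continuous_mul; last exact/mx_continuousV/rep_continuous.
by apply: mx_continuous_mul; [exact: rep_continuous|exact: mx_continuous_cst].
Qed.

(** Multiplying by [phi (k^-1)] on the left and [psi k] on the right replaces [g] by [k^-1 * g]
    under the mean, so left invariance suffices. *)
Lemma intertwinerP phi psi (X : 'M[C]_(rep_dim phi, rep_dim psi)) k :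
  phi k *m intertwiner X = intertwiner X *m psi k.
Proof.
rewrite -[RHS]mul1mx -(rep_mulVr phi k) -mulmxA; congr (_ *m _).
rewrite mulmxA /intertwiner -mxmean_mul2; last exact: intertwiner_continuous.
rewrite -[LHS](@mxmean_mulgl _ _ (k^-1)%g
  (fun g => phi g *m X *m psi (g^-1)%g)); last first.
  exact: intertwiner_continuous.
congr mxmean; apply/funext => g.
by rewrite rep_M invgM invgK rep_M !mulmxA.
Qed.

End Averaging.

(** * Schur's lemma *)

Section Schur.
Variables (R : realType) (G : topologicalGroupType).
Local Notation C := R[i].
Implicit Types (rho sigma phi psi : rep R G).

Lemma eq_mulmx_col m n (A B : 'M[C]_(m, n)) :
  (forall v : 'cV[C]_n, A *m v = B *m v) -> A = B.
Proof.
move=> h; apply/matrixP => i j.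
have /matrixP/(_ i 0) := h (delta_mx j 0).
by rewrite -!colE !mxE.
Qed.

(** The kernel and the image of [T] are invariant, hence trivial or everything. *)
Lemma schur phi psi (T : 'M[C]_(rep_dim psi, rep_dim phi)) :
  rep_irreducible phi -> rep_irreducible psi ->
  (forall g, T *m phi g = psi g *m T) ->
  T = 0 \/ exists Q, T *m Q = 1%:M /\ Q *m T = 1%:M.
Proof.
move=> [phi0 irr_phi] [psi0 irr_psi] TI.
pose f := linfun (mulmx T : 'cV_(rep_dim phi) -> 'cV_(rep_dim psi)).
have fE v : f v = T *m v by rewrite lfunE.
have [|kf0|kfT] := irr_phi (lker f).
- move=> g v; rewrite !memv_ker !fE => /eqP Tv.
  by rewrite mulmxA TI -mulmxA Tv mulmx0.
- have [|if0|ifT] := irr_psi (limg f).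
  + move=> g w /memv_imgP[v _ ->]; rewrite fE mulmxA -TI -mulmxA -fE.
    exact: memv_img (memvf _).
  + left; apply: eq_mulmx_col => v; rewrite mul0mx -fE.
    have := memv_img f (memvf v); rewrite if0 memv0 => /eqP //.
  + right.
    have inj (v : 'cV_(rep_dim phi)) : T *m v = 0 -> v = 0.
      move=> Tv; have : v \in lker f by rewrite memv_ker fE Tv.
      by rewrite kf0 memv0 => /eqP.
    have surj (w : 'cV_(rep_dim psi)) : exists v, T *m v = w.
      have : w \in limg f by rewrite ifT memvf.
      by move=> /memv_imgP[v _ ->]; exists v; rewrite fE.
    have [q qP] := choice surj.
    (* The columns of [Q] are chosen preimages of the basis vectors. *)
    pose Q := \matrix_(i, j) q (delta_mx j 0) i 0.
    have TQ : T *m Q = 1%:M.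
      apply/matrixP => i j.
      have /matrixP/(_ i 0) := qP (delta_mx j 0); rewrite !mxE.
      rewrite eqxx andbT => <-; apply: eq_bigr => k _; by rewrite !mxE.
    exists Q; split => //; apply: eq_mulmx_col => v; apply/eqP;
      rewrite -subr_eq0.
    apply/eqP/inj; rewrite mulmxBr !mulmxA TQ !mul1mx mulmx1; exact: subrr.
- left; apply: eq_mulmx_col => v; rewrite mul0mx -fE.
  have : v \in lker f by rewrite kfT memvf.
  by rewrite memv_ker => /eqP.
Qed.

(** For a root [a] of the characteristic polynomial, [T - a%:M] kills a nonzero row vector, so it is
    not invertible and must vanish. *)
Lemma schur_scalar phi (T : 'M[C]_(rep_dim phi)) :
  rep_irreducible phi -> (forall g, T *m phi g = phi g *m T) ->
  exists a : C, T = a%:M.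
Proof.
move=> irr TI; have [phi0 _] := irr.
have [|a] := closed_rootP (char_poly T) _.
  by rewrite size_char_poly; case: (rep_dim phi) phi0.
rewrite -eigenvalue_root_char => /eigenvalueP[v vT v0].
exists a.
have [|/eqP|[Q [TQ _]]] := @schur phi phi (T - a%:M) irr irr.
- by move=> g; rewrite mulmxBl mulmxBr TI scalar_mxC.
- by rewrite subr_eq0 => /eqP.
- exfalso; move/eqP : v0; apply.
  by rewrite -[v]mulmx1 -TQ mulmxA mulmxBr vT mul_mx_scalar subrr mul0mx.
Qed.

End Schur.

(** * Orthogonality of matrix coefficients *)

Section Orthogonality.
Variables (R : realType) (G : topologicalGroupType).
Variable mu : probability (borel G) R.
Hypothesis Gc : compact [set: G].
Hypothesis muL : haar mu.
Local Notation C := R[i].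
Local Notation cmean := (haar_cmean mu).
Implicit Types (rho sigma phi psi : rep R G).

Let mul_deltaE m n p q (A : 'M[C]_(m, n)) (B : 'M[C]_(p, q)) i j k l :
  (A *m delta_mx j k *m B) i l = A i j * B k l.
Proof.
rewrite mxE (bigD1 k)//= big1 ?addr0 => [|k' k'k].
  rewrite mxE (bigD1 j)//= big1 ?addr0 => [|j' j'j]; rewrite mxE ?eqxx ?mulr1//.
  by rewrite (negbTE j'j) mulr0.
rewrite mxE big1 ?mul0r// => j' _; rewrite mxE (negbTE k'k) andbF mulr0//.
Qed.

(** The mean is an entry of the intertwiner built from a matrix unit, which Schur's lemma makes
    0. *)
Lemma coef_ortho phi psi i j k l :
  rep_irreducible phi -> rep_irreducible psi -> ~ rep_iso phi psi ->
  cmean (fun g => phi g i j * psi (g^-1)%g k l) = 0.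
Proof.
move=> irr_phi irr_psi niso.
have [T0|[Q [TQ QT]]] :=
    @schur R G psi phi (intertwiner mu (delta_mx j k)) irr_psi irr_phi
     (fun g => esym (intertwinerP Gc muL (delta_mx j k) g)).
  move/matrixP/(_ i l) : T0; rewrite !mxE => <-; congr cmean.
  by apply/funext => g; rewrite mul_deltaE.
exfalso; apply/niso/rep_iso_sym.
exists (intertwiner mu (delta_mx j k)), Q; split => // g.
by rewrite intertwinerP.
Qed.

(** Here the intertwiner of a matrix unit is a scalar matrix. Its scalar is found from the trace,
    which conjugation by [phi g] preserves. *)
Lemma coef_ortho_self phi i j k l : rep_irreducible phi ->
  cmean (fun g => phi g i j * phi (g^-1)%g k l) =
  (i == l)%:R * (j == k)%:R / (rep_dim phi)%:R.
Proof.
move=> irr; have [phi0 _] := irr.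
have [a aE] := schur_scalar irr
     (fun g => esym (intertwinerP Gc muL (delta_mx j k) g)).
have : \tr (intertwiner mu (delta_mx j k : 'M[C]_(rep_dim phi))) = (j == k)%:R.
  rewrite mxtrace_mean//; last exact: intertwiner_continuous.
  under eq_fun do rewrite -mulmxA mxtrace_mulC -mulmxA rep_mulVl mulmx1.
  rewrite cmean_cst /mxtrace (bigD1 j)//= big1 ?addr0 ?mxE ?eqxx// => j' j'j.
  by rewrite mxE (negbTE j'j).
rewrite aE mxtrace_scalar => ad.
have d0 : (rep_dim phi)%:R != 0 :> C by rewrite pnatr_eq0 -lt0n.
have -> : cmean (fun g => phi g i j * phi (g^-1)%g k l) =
    intertwiner mu (delta_mx j k : 'M[C]_(rep_dim phi)) i l.
  by rewrite mxE; congr cmean; apply/funext => g; rewrite mul_deltaE.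
by rewrite aE mxE -mulrA -ad -[a *+ rep_dim phi]mulr_natr mulfK// mulr_natl.
Qed.

End Orthogonality.

(** * Characters *)

Section Characters.
Variables (R : realType) (G : topologicalGroupType).
Variable mu : probability (borel G) R.
Hypothesis Gc : compact [set: G].
Hypothesis muL : haar mu.
Local Notation C := R[i].
Local Notation cmean := (haar_cmean mu).
Implicit Types (rho sigma phi psi : rep R G).

Lemma ccont_char rho : ccont (rep_char rho).
Proof. by apply: ccont_sum => i; exact: rep_continuous. Qed.

Lemma rep_char_iso rho sigma : rep_iso rho sigma ->
  rep_char rho =1 rep_char sigma.
Proof.
move=> [P [Q [PQ QP PI]]] g; rewrite /rep_char.
by rewrite -[rho g]mul1mx -QP -mulmxA PI mulmxA mxtrace_mulC mulmxA PQ mul1mx.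
Qed.

Lemma rep_char_dsum rho sigma g :
  rep_char (rep_dsum rho sigma) g = rep_char rho g + rep_char sigma g.
Proof. exact: mxtrace_block. Qed.

Lemma rep_char_conj rho g : rep_char (rep_conj rho) g = (rep_char rho g)^*.
Proof.
rewrite /rep_char /mxtrace rmorph_sum; apply: eq_bigr => i _.
by rewrite mxE.
Qed.

Lemma rep_char_tens rho sigma g :
  rep_char (rep_tens rho sigma) g = rep_char rho g * rep_char sigma g.
Proof.
rewrite /rep_char /mxtrace /= big_distrlr /= pair_big /=.
rewrite (reindex (@mxtens_index (rep_dim rho) (rep_dim sigma))) /=; last first.
  exists (@mxtens_unindex (rep_dim rho) (rep_dim sigma)) => x _.
    exact: mxtens_indexK.
  exact: mxtens_unindexK.
by apply: eq_bigr => -[i j] _; rewrite /rep_tens_mx tensmxE.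
Qed.

Lemma rep_char_J rho g h : rep_char rho (h * g * h^-1)%g = rep_char rho g.
Proof.
rewrite /rep_char !rep_M mxtrace_mulC mulmxA rep_mulVl mul1mx//.
Qed.

(* The average [H] of [rho(g^-1)^* rho(g^-1)] is an invariant positive definite
   form, hence conjugates the inverse of [rho g] into its adjoint. *)
Lemma rep_charV rho g : rep_char rho (g^-1)%g = (rep_char rho g)^*.
Proof.
pose adj m n (M : 'M[C]_(m, n)) : 'M[C]_(n, m) := (map_mx Num.conj M)^T.
have adjM m n p (M : 'M[C]_(m, n)) (N : 'M[C]_(n, p)) :
    adj _ _ (M *m N) = adj _ _ N *m adj _ _ M.
  by rewrite /adj map_mxM trmx_mul.
pose F g := adj _ _ (rho (g^-1)%g) *m rho (g^-1)%g.
have cF : mx_continuous F.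
  apply: mx_continuous_mul; last exact/mx_continuousV/rep_continuous.
  exact/mx_continuous_adj/mx_continuousV/rep_continuous.
pose H := mxmean mu F.
have HI k : adj _ _ (rho k) *m H *m rho k = H.
  rewrite /H -(mxmean_mul2 mu Gc); last exact: cF.
  rewrite -[RHS](mxmean_mulgl Gc muL (k^-1)%g cF).
  congr mxmean; apply/funext => x; rewrite /F invgM invgK rep_M adjM.
  by rewrite !mulmxA.
(* If [v] is killed by [H], the squared norm [f g] of [rho (g^-1)] applied to the adjoint of [v] has
   mean 0, although it is positive everywhere when [v] is nonzero. *)
have Hu : H \in unitmx.
  rewrite unitmxE unitfE; apply/det0P => -[v v0 vH].
  pose u g := rho (g^-1)%g *m adj _ _ v.
  have cu : mx_continuous u.
    apply: mx_continuous_mul; first exact/mx_continuousV/rep_continuous.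
    exact: mx_continuous_cst.
  pose f g : R := \sum_i (complex.Re (u g i 0) ^+ 2 + complex.Im
    (u g i 0) ^+ 2).
  have fE g0 : (f g0)%:C%C = (adj _ _ (u g0) *m u g0) 0 0.
    rewrite mxE rmorph_sum; apply: eq_bigr => i _.
    by apply: (etrans (add_Re2_Im2 _)); rewrite !mxE normCK mulrC.
  have cf : continuous f.
    have csq (h : G -> R) : continuous h -> continuous (fun x => h x ^+ 2).
      by move=> ch x; apply: (@continuous_comp _ _ _ h (fun y => y ^+ 2));
        [exact: ch|exact: sqr_continuous].
    apply: continuous_sum => i x; apply: cvgD.
      exact: (csq _ (ccont_Re (cu i 0))).
    exact: (csq _ (ccont_Im (cu i 0))).
  have f0 g0 : 0 < f g0.
    have fge : 0 <= f g0 by apply: sumr_ge0 => i _; rewrite addr_ge0// sqr_ge0.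
    rewrite lt_neqAle fge andbT eq_sym; apply/eqP => f00.
    have u0 : u g0 = 0.
      apply/matrixP => i j; rewrite [j]ord1 [RHS]mxE.
      have /eqP := f00; rewrite psumr_eq0; last first.
        by move=> i' _; rewrite addr_ge0// sqr_ge0.
      move=> /allP/(_ i (mem_index_enum _)) /=.
      rewrite paddr_eq0 ?sqr_ge0// !sqrf_eq0 => /andP[/eqP h1 /eqP h2].
      by apply/eqP; rewrite eq_complex h1 h2 !eqxx.
    have : adj _ _ v = 0.
      by rewrite -[adj _ _ v]mul1mx -(rep_mulVr rho g0) -mulmxA -/(u g0) u0
        mulmx0.
    move=> /matrixP av; move/eqP : v0; apply; apply/matrixP => i j.
    have := av j i; rewrite !mxE => /eqP.
    by rewrite fmorph_eq0 => /eqP.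
  have := cmean_neq0 mu Gc cf f0; rewrite (_ : cmean _ = 0) ?eqxx//.
  have : (v *m H *m adj _ _ v) 0 0 = 0 by rewrite vH mul0mx mxE.
  rewrite /H -(mxmean_mul2 mu Gc); last exact: cF.
  rewrite mxE => <-; congr cmean; apply/funext => x; rewrite fE.
  have adjK : adj _ _ (adj _ _ v) = v by apply/matrixP => i j;
    rewrite !mxE conjCK.
  by rewrite /u adjM adjK /F !mulmxA.
have HE : rho (g^-1)%g = invmx H *m adj _ _ (rho g) *m H.

  have := HI g => /(congr1 (fun M => invmx H *m (M *m rho (g^-1)%g))).
  rewrite -[_ *m _ *m rho g *m _]mulmxA rep_mulVr mulmx1.
  by rewrite [X in _ = X]mulmxA mulVmx// mul1mx mulmxA => <-.
rewrite /rep_char HE mxtrace_mulC mulmxA mulmxV// mul1mx /adj mxtrace_tr.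
by rewrite /mxtrace rmorph_sum; apply: eq_bigr => i _; rewrite mxE.
Qed.

Lemma char_ortho phi psi : rep_irreducible phi -> rep_irreducible psi ->
  cmean (fun g => rep_char phi g * (rep_char psi g)^*) =
  `[< rep_iso phi psi >]%:R.
Proof.
move=> irr_phi irr_psi.
have E rho : cmean (fun g => rep_char phi g * (rep_char rho g)^*) =
    \sum_i \sum_k cmean (fun g => phi g i i * rho (g^-1)%g k k).
  under [RHS]eq_bigr => i _.
    rewrite -(cmean_sum mu Gc); last first.
      move=> k; apply: ccontM; first exact: rep_continuous.
      exact: (mx_continuousV (@rep_continuous _ _ rho)).
    over.
  rewrite -(cmean_sum mu Gc); last first.
    move=> i; apply: ccont_sum => k; apply: ccontM; first exact: rep_continuous.
    exact: (mx_continuousV (@rep_continuous _ _ rho)).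
  congr cmean; apply/funext => g;
    rewrite -rep_charV /rep_char /mxtrace big_distrlr.
  by [].
have [iso|niso] := pselect (rep_iso phi psi); last first.
  rewrite asboolF// E big1// => i _; rewrite big1// => k _.
  exact: coef_ortho.
rewrite asboolT//.
rewrite (_ : (fun g => _) = fun g => rep_char phi g * (rep_char phi g)^*);
  last first.
  by apply/funext => g; rewrite (rep_char_iso iso).
have d0 : (rep_dim phi)%:R != 0 :> C by case: irr_phi; rewrite pnatr_eq0 -lt0n.
rewrite E; transitivity (\sum_(i < rep_dim phi) ((rep_dim phi)%:R : C)^-1).
  apply: eq_bigr => i _; rewrite (bigD1 i)//= big1 => [|k ki].
    by rewrite (coef_ortho_self Gc muL)// eqxx !mul1r addr0.
  by rewrite (coef_ortho_self Gc muL)// eq_sym (negbTE ki) !mul0r.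
by rewrite sumr_const card_ord -[_ *+ _]mulr_natl mulfV.
Qed.

(** The mean of [phi (h^-1 * a * h)] is a scalar matrix. With the inverse in front it is not an
    [intertwiner], and only left invariance is at hand, so its entries are computed from
    [coef_ortho_self]. *)
Lemma char_average phi a g : rep_irreducible phi ->
  cmean (fun h => rep_char phi (h^-1 * a * h * g)%g) =
  rep_char phi a / (rep_dim phi)%:R * rep_char phi g.
Proof.
move=> irr.
pose F h := phi (h^-1)%g *m phi a *m phi h.
have cF : mx_continuous F.
  apply: mx_continuous_mul; last exact: rep_continuous.
  apply: mx_continuous_mul; last exact: mx_continuous_cst.
  exact/mx_continuousV/rep_continuous.
have -> : (fun h => rep_char phi (h^-1 * a * h * g)%g) =
  fun h => \tr (F h *m phi g).
  by apply/funext => h; rewrite /rep_char !rep_M.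
rewrite -(mxtrace_mean mu Gc (F := fun h => F h *m phi g)); last first.
  by apply: mx_continuous_mul cF _; exact: mx_continuous_cst.
rewrite (mxmean_mulr mu Gc (phi g) cF).
have -> : mxmean mu F = (rep_char phi a / (rep_dim phi)%:R)%:M.
  apply/matrixP => i l; rewrite !mxE.
  rewrite (_ : (fun h => F h i l) = fun h => \sum_k \sum_j
      phi a j k * (phi h k l * phi (h^-1)%g i j)); last first.
    apply/funext => h; rewrite mxE; apply: eq_bigr => k _.
    rewrite mxE mulr_suml; apply: eq_bigr => j _; ring.
  have cc j k : ccont (fun h => phi h k l * phi (h^-1)%g i j).
    apply: ccontM; first exact: rep_continuous.
    exact: (mx_continuousV (@rep_continuous _ _ phi)).
  rewrite (cmean_sum mu Gc); last first.
    move=> k; apply: ccont_sum => j.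
    by apply: ccontM; [exact: ccont_cst|exact: cc].
  rewrite -[RHS]mulr_natr /rep_char /mxtrace !mulr_suml; apply: eq_bigr => k _.
  rewrite (cmean_sum mu Gc); last first.
    by move=> j; apply: ccontM; [exact: ccont_cst|exact: cc].
  rewrite (bigD1 k)//= big1 ?addr0 => [|j jk]; rewrite (cmeanZ mu Gc)//.
    by rewrite (coef_ortho_self Gc muL)// eqxx mul1r [l == i]eq_sym; ring.
  by rewrite (coef_ortho_self Gc muL)// eq_sym (negbTE jk) !mul0r mulr0.
by rewrite mul_scalar_mx mxtraceZ.
Qed.

End Characters.

(** * Subrepresentations and complete reducibility *)

Section Corner.
Variables (R : realType) (G : topologicalGroupType).
Local Notation C := R[i].
Variables (rho : rep R G) (r : nat).
Variables (cb : 'M[C]_(rep_dim rho, r)) (rb : 'M[C]_(r, rep_dim rho)).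
Hypothesis rbcb : rb *m cb = 1%:M.
Hypothesis cbrbC : forall g, cb *m rb *m rho g = rho g *m (cb *m rb).

(* The subrepresentation on the image of the idempotent [cb *m rb]. *)
Definition corner_mx (g : G) := rb *m rho g *m cb.

Lemma corner_mx_rb g : corner_mx g *m rb = rb *m rho g.
Proof.
by rewrite /corner_mx -!mulmxA -cbrbC -mulmxA mulmxA rbcb mul1mx.
Qed.

Lemma cb_corner_mx g : cb *m corner_mx g = rho g *m cb.
Proof.
by rewrite /corner_mx !mulmxA cbrbC -!mulmxA rbcb mulmx1.
Qed.

Fact corner_1 : corner_mx 1%g = 1%:M.
Proof. by rewrite /corner_mx rep_1 mulmx1 rbcb. Qed.

Fact corner_M g h : corner_mx (g * h)%g = corner_mx g *m corner_mx h.
Proof.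
transitivity (rb *m rho g *m (cb *m corner_mx h)); last by rewrite mulmxA.
by rewrite cb_corner_mx /corner_mx rep_M !mulmxA.
Qed.

Fact corner_continuous : mx_continuous corner_mx.
Proof.
apply: mx_continuous_mul; last exact: mx_continuous_cst.
by apply: mx_continuous_mul; [exact: mx_continuous_cst|exact: rep_continuous].
Qed.

Definition corner : rep R G := Rep corner_1 corner_M corner_continuous.

End Corner.

Section Decomposition.
Variables (R : realType) (G : topologicalGroupType).
Variable mu : probability (borel G) R.
Hypothesis Gc : compact [set: G].
Hypothesis muL : haar mu.
Local Notation C := R[i].
Local Notation cmean := (haar_cmean mu).
Implicit Types (rho sigma phi psi : rep R G).

Definition comm_idem rho (p : 'M[C]_(rep_dim rho)) :=
  p *m p = p /\ forall g, p *m rho g = rho g *m p.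

(** In the rank factorization [p = c *m d], cancelling the outer factors of
    [c *m d *m c *m d = c *m d] leaves [d *m c = 1%:M]. *)
Lemma idem_factor n (p : 'M[C]_n) : p *m p = p ->
  exists (c : 'M[C]_(n, \rank p)) (d : 'M[C]_(\rank p, n)),
    c *m d = p /\ d *m c = 1%:M.
Proof.
have := mulmx_base p; have := mulVpmx (col_base_full p).
have := mulmxVp (row_base_free p).
move: (col_base p) (row_base p) (pinvmx (col_base p)) (pinvmx (row_base p)).
move=> c d c' d' dd' c'c cd pp.
exists c, d; split => //.
have : c' *m (c *m d *m (c *m d)) *m d' = c' *m (c *m d) *m d' by rewrite cd pp.
by rewrite !mulmxA c'c !mul1mx dd' -mulmxA dd' mulmx1.
Qed.

Lemma idem_rank_lt n (p : 'M[C]_n) : p *m p = p -> p <> 1%:M -> (\rank p < n)%N.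
Proof.
move=> pp p1; rewrite ltn_neqAle rank_leq_row andbT; apply/negP => rp.
apply: p1; have pu : p \in unitmx by rewrite -row_free_unit.
by rewrite -[p]mul1mx -(mulVmx pu) -mulmxA pp.
Qed.

Lemma matrix_of_end n (f : 'End('cV[C]_n)) : exists P : 'M[C]_n, forall v,
  P *m v = f v.
Proof.
exists (\matrix_(i, j) f (delta_mx j 0) i 0) => v.
have vE : v = \sum_j v j 0 *: delta_mx j 0.
  apply/matrixP => i k; rewrite [k]ord1 summxE (bigD1 i)//= big1 => [|j ji].
    by rewrite !mxE !eqxx mulr1 addr0.
  by rewrite !mxE [i == j]eq_sym (negbTE ji) mulr0.
rewrite [in RHS]vE linear_sum; apply/matrixP => i k;
  rewrite [k]ord1 !mxE summxE.
by apply: eq_bigr => j _; rewrite linearZ !mxE mulrC.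
Qed.

(* Averaging a projection onto an invariant subspace. *)
Lemma reducible_idem rho : (0 < rep_dim rho)%N -> ~ rep_irreducible rho ->
  exists p, [/\ @comm_idem rho p, p <> 0 & p <> 1%:M].
Proof.
move=> rho0 nirr.
have [U [stU U0 UT]] : exists U : {vspace 'cV[C]_(rep_dim rho)},
    [/\ forall g v, v \in U -> rho g *m v \in U, U <> 0%VS & U <> fullv].
  apply: contrapT => h; apply: nirr; split => // U stU.
  apply: contrapT => /not_orP[U0 UT]; apply: h; exists U; split => //.
have [P PE] := matrix_of_end (projv U).
have PU v : P *m v \in U by rewrite PE memv_proj.
have Pid v : v \in U -> P *m v = v by move=> vU; rewrite PE projv_id.
pose p := @intertwiner R G mu rho rho P.
have cP := @intertwiner_continuous R G rho rho P.
(* Every averaged matrix has its image in [U] and is the identity on [U]. With [pP] this makes [p]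
   an idempotent of image [U]. *)
have Pp : P *m p = p.
  rewrite /p /intertwiner -(mxmean_mull mu Gc); last exact: cP.
  congr mxmean; apply/funext => g; rewrite !mulmxA; congr (_ *m _).
  by apply: eq_mulmx_col => v; rewrite -!mulmxA Pid//; apply: stU.
have pP : p *m P = P.
  rewrite /p /intertwiner -(mxmean_mulr mu Gc); last exact: cP.
  rewrite -[RHS](mxmean_cst mu); congr mxmean; apply/funext => g.
  rewrite -[RHS]mul1mx -(rep_mulVr rho g) -!mulmxA; congr (_ *m _).
  by apply: eq_mulmx_col => v; rewrite -!mulmxA Pid//; apply: stU.
exists p; split.
- split; first by rewrite -{2}Pp mulmxA pP.
  by move=> g; rewrite intertwinerP.
- move=> p0; apply: U0; apply/eqP; rewrite -subv0; apply/subvP => v vU.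
  by rewrite memv0 -(Pid _ vU) -pP p0 !mul0mx.
- move=> p1; apply: UT; apply/eqP; rewrite eqEsubv subvf /=; apply/subvP => v _.
  by rewrite -[v]mul1mx -p1 -Pp -mulmxA.
Qed.

(** A corner of least positive size is irreducible. A corner of a corner is again described as a
    corner of [rho], through the products [c *m c'] and [d' *m d], so the descent never leaves
    [rho]. *)
Lemma exists_irr_corner rho : (0 < rep_dim rho)%N ->
  exists r (c : 'M[C]_(rep_dim rho, r)) (d : 'M[C]_(r, rep_dim rho))
    (dc : d *m c = 1%:M) (cdC : forall g, c *m d *m rho g = rho g *m (c *m d)),
    (0 < r)%N /\ rep_irreducible (corner dc cdC).
Proof.
move=> rho0.
suff: forall n r (c : 'M[C]_(rep_dim rho, r)) (d : 'M[C]_(r, rep_dim rho))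
    (dc : d *m c = 1%:M) (cdC : forall g, c *m d *m rho g = rho g *m (c *m d)),
    (0 < r < n)%N -> exists r (c : 'M[C]_(rep_dim rho, r))
    (d : 'M[C]_(r, rep_dim rho))
    (dc : d *m c = 1%:M) (cdC : forall g, c *m d *m rho g = rho g *m (c *m d)),
    (0 < r)%N /\ rep_irreducible (corner dc cdC).
  move=> /(_ (rep_dim rho).+1 (rep_dim rho) 1%:M 1%:M); apply.
  - by rewrite mulmx1.
  - by move=> g; rewrite !mulmx1 mul1mx.
  - by rewrite rho0 /=.
elim=> [|n IH] r c d dc cdC; first by rewrite ltn0 andbF.
move=> /andP[r0 rn].
have [irr|nirr] := pselect (rep_irreducible (corner dc cdC)).
  by exists r, c, d, dc, cdC.
have [e [[ee ec] e0 e1]] := @reducible_idem (corner dc cdC) r0 nirr.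
have rke : (0 < \rank e < n)%N.
  rewrite lt0n mxrank_eq0; apply/andP; split; first exact/eqP.
  by apply: leq_trans (idem_rank_lt ee e1) _; exact: rn.
have [c' [d' [c'd' d'c']]] := idem_factor ee.
move: (\rank e) c' d' c'd' d'c' rke => r' c' d' c'd' d'c' rke.
rewrite /= in c' d' c'd' d'c'.
apply: (IH r' (c *m c') (d' *m d)) rke.
- by rewrite mulmxA -(mulmxA d') dc mulmx1.
- move=> g.
  have -> : c *m c' *m (d' *m d) = c *m e *m d by rewrite -c'd' !mulmxA.
  have ecg : e *m corner_mx c d g = corner_mx c d g *m e := ec g.
  move: ecg (corner_mx_rb dc cdC g) (cb_corner_mx dc cdC g).
  move: (corner_mx c d g) => M eM Md cM.
  by rewrite -mulmxA -Md !mulmxA -cM -(mulmxA c e) eM mulmxA.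
Qed.

(** The complement is the corner of [1%:M - c *m d]; it is smaller than [rho] because [r] is
    positive. *)
Lemma corner_split rho r (c : 'M[C]_(rep_dim rho, r)) (d : 'M[C]_(r,
  rep_dim rho))
    (dc : d *m c = 1%:M) (cdC : forall g, c *m d *m rho g = rho g *m (c *m d)) :
  (0 < r)%N -> exists sigma : rep R G,
    (rep_dim sigma < rep_dim rho)%N /\ rep_iso rho (rep_dsum
      (corner dc cdC) sigma).
Proof.
move=> r0; pose q := 1%:M - c *m d.
have qq : q *m q = q.
  rewrite /q mulmxBl mul1mx mulmxBr mulmx1 !mulmxA -(mulmxA c) dc mulmx1 subrr.
  by rewrite subr0.
have dq : d *m q = 0 by rewrite /q mulmxBr mulmx1 mulmxA dc mul1mx subrr.
have qc : q *m c = 0 by rewrite /q mulmxBl mul1mx -mulmxA dc mulmx1 subrr.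
have qC g : q *m rho g = rho g *m q.
  by rewrite /q mulmxBl mulmxBr mul1mx mulmx1 cdC.
have q1 : q <> 1%:M.
  move=> q1; have := qc; rewrite q1 mul1mx => c0.
  move/matrixP/(_ (Ordinal r0) (Ordinal r0)) : dc; rewrite c0 mulmx0 !mxE eqxx.
  by move=> /eqP; rewrite eq_sym oner_eq0.
have := idem_rank_lt qq q1.
have [c' [d' [c'd' d'c']]] := idem_factor qq.
move: (\rank q) c' d' c'd' d'c' => r' c' d' c'd' d'c' r'lt.
have c'd'C g : c' *m d' *m rho g = rho g *m (c' *m d') by rewrite c'd' qC.
exists (corner d'c' c'd'C); split => //.
have d'c : d' *m c = 0.
  by rewrite -[d']mul1mx -d'c' -(mulmxA d') c'd' -mulmxA qc mulmx0.
have dc' : d *m c' = 0.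
  by rewrite -[c']mulmx1 -d'c' (mulmxA c') c'd' mulmxA dq mul0mx.
exists (col_mx d d'), (row_mx c c'); split => [||g].
- by rewrite mul_col_row dc d'c' d'c dc' -scalar_mx_block.
- by rewrite mul_row_col c'd' /q addrC subrK.
- rewrite mul_col_mx /= /rep_dsum_mx mul_block_col !mul0mx addr0 add0r /=.
  by rewrite (corner_mx_rb dc cdC) (corner_mx_rb d'c' c'd'C).
Qed.

Lemma rep_dsum_isor rho sigma psi :
  rep_iso sigma psi -> rep_iso (rep_dsum rho sigma) (rep_dsum rho psi).
Proof.
move=> [P [Q [PQ QP PI]]].
exists (block_mx 1%:M 0 0 P), (block_mx 1%:M 0 0 Q); split => [||g].
- by rewrite mulmx_block !mul0mx !mulmx0 mulmx1 PQ !addr0 !add0r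
  -scalar_mx_block.
- by rewrite mulmx_block !mul0mx !mulmx0 mulmx1 QP !addr0 !add0r
  -scalar_mx_block.
- rewrite /= /rep_dsum_mx !mulmx_block !mul0mx !mulmx0 mulmx1 mul1mx !addr0
  !add0r.
  by rewrite PI.
Qed.

Lemma rep_decomp rho : exists s : seq (rep R G),
  (forall sigma, sigma \in s -> rep_irreducible sigma) /\
  rep_iso rho (foldr (@rep_dsum R G) (rep_zero R G) s).
Proof.
have [n] := ubnP (rep_dim rho); elim: n => // n IH in rho *; rewrite ltnS => rn.
have [r0|r0] := posnP (rep_dim rho).
  exists [::]; split => //; exists 0, 0; split => [||g].
  - by apply/matrixP => -[].
  - by apply/matrixP => i; have := ltn_ord i; rewrite {2}r0.
  - by apply/matrixP => -[].
have [r [c [d [dc [cdC [rgt0 irr]]]]]] := exists_irr_corner r0.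
have [sigma [lt_sigma iso_sigma]] := corner_split dc cdC rgt0.
have [|s [sirr siso]] := IH sigma; first exact: leq_trans rn.
exists (corner dc cdC :: s); split.
  by move=> psi; rewrite inE => /orP[/eqP ->//|]; exact: sirr.
exact: rep_iso_trans iso_sigma (rep_dsum_isor _ siso).
Qed.

Lemma rep_char_foldr (s : seq (rep R G)) g :
  rep_char (foldr (@rep_dsum R G) (rep_zero R G) s) g =
  \sum_(sigma <- s) rep_char sigma g.
Proof.
elim: s => [|sigma s IH] /=;
  first by rewrite big_nil /rep_char /mxtrace big_ord0.
by rewrite big_cons -IH -rep_char_dsum.
Qed.

Lemma char_ortho_seq (s : seq (rep R G)) phi :
  (forall sigma, sigma \in s -> rep_irreducible sigma) -> rep_irreducible phi ->
  cmean (fun g => (\sum_(sigma <- s) rep_char sigma g) * (rep_char phi g)^*) =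
  (count (fun sigma => `[< rep_iso phi sigma >]) s)%:R.
Proof.
move=> irr_s irr_phi.
under eq_fun do rewrite mulr_suml.
rewrite (cmean_sum mu Gc); last first.
  by move=> sigma; apply: ccontM;
    [exact: ccont_char|exact/ccont_conj/ccont_char].
elim: s irr_s => [|sigma s IH] irr_s; first by rewrite big_nil.
rewrite big_cons IH => [|x xs]; last by apply: irr_s; rewrite inE xs orbT.
rewrite (char_ortho Gc muL)//; last by apply: irr_s; rewrite inE eqxx.
rewrite /= natrD; congr (_%:R + _).
by congr nat_of_bool; apply/asbool_equiv_eq; split; exact: rep_iso_sym.
Qed.

(** Every decomposition gives the same count, so the choice made by [xget] is harmless, and
    [rep_decomp] rules out its default value 0. *)
Lemma rep_multE phi rho : rep_irreducible phi ->
  (rep_mult phi rho)%:R = cmean (fun g => rep_char rho g * (rep_char phi g)^*).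
Proof.
move=> irr_phi; rewrite /rep_mult; case: xgetP => [k _|].
  move=> [s [irr_s iso_s ->]]; rewrite -(char_ortho_seq irr_s irr_phi).
  congr cmean; apply/funext => g.
  by rewrite (rep_char_iso iso_s) rep_char_foldr.
have [s [irr_s iso_s]] := rep_decomp rho.
by move=> /(_ (count (fun sigma => `[< rep_iso phi sigma >]) s)) []; exists s.
Qed.

Lemma irr_reps_irr phi : irr_reps phi -> rep_irreducible phi.
Proof. by case. Qed.

Lemma irr_reps_iso phi psi :
  irr_reps phi -> irr_reps psi -> rep_iso phi psi -> phi = psi.
Proof.
move=> iphi ipsi iso.
have [x [_ xU]] := irr_repsP (irr_reps_irr iphi).
by rewrite -(xU phi) ?(xU psi)//; split => //; exact: rep_iso_refl.
Qed.

(** Reduces the sums over the possibly infinite set [irr_reps] to the finite list [s]. *)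
Lemma char_decomp rho : exists s : seq (rep R G),
  [/\ uniq s, forall phi, phi \in s -> irr_reps phi,
      forall phi, irr_reps phi -> phi \notin s -> rep_mult phi rho = 0%N &
      forall g, rep_char rho g =
        \sum_(phi <- s) (rep_mult phi rho)%:R * rep_char phi g].
Proof.
have [s0 [irr0 iso0]] := rep_decomp rho.
have /choice[r rP] : forall sigma : rep R G, exists phi : rep R G,
    rep_irreducible sigma -> irr_reps phi /\ rep_iso sigma phi.
  move=> sigma.
  have [irr|nirr] := pselect (rep_irreducible sigma); last by exists sigma.
  by have [x [xP _]] := irr_repsP irr; exists x.
pose t := map r s0; pose s := undup t.
have tirr phi : phi \in t -> irr_reps phi.
  by move=> /mapP[sigma /irr0 irr ->]; exact: (rP _ irr).1.
have sirr phi : phi \in s -> irr_reps phi by rewrite mem_undup; exact: tirr.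
have rhoE g : rep_char rho g = \sum_(phi <- t) rep_char phi g.
  rewrite (rep_char_iso iso0) rep_char_foldr big_map big_seq [RHS]big_seq.
  by apply: eq_bigr => sigma /irr0 irr; exact: rep_char_iso (rP _ irr).2 g.
have mE phi : irr_reps phi -> rep_mult phi rho = count_mem phi t.
  move=> iphi; apply/eqP; rewrite -(eqr_nat C); apply/eqP.
  rewrite rep_multE; last exact: irr_reps_irr.
  under eq_fun do rewrite rhoE.
  rewrite char_ortho_seq; [|by move=> sigma /tirr/irr_reps_irr|exact:
    irr_reps_irr].
  congr (_%:R); apply: eq_in_count => sigma /tirr isigma /=.
  apply/asboolP/eqP => [iso|->]; last exact: rep_iso_refl.
  by apply/esym; exact: irr_reps_iso.
exists s; split => //.
- exact: undup_uniq.
- move=> phi iphi; rewrite mem_undup mE// => /count_memPn //.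
- move=> g; rewrite rhoE -big_undup_iterop_count/=.
  rewrite big_seq [RHS]big_seq; apply: eq_bigr => phi /sirr iphi.
  by rewrite mE// mulr_natl; case: (count_mem _ _) => //= k;
    rewrite Monoid.iteropE.
Qed.

End Decomposition.

(** * Exchangeable pairs *)

Section Separated.
Variables (R : realType) (G : topologicalGroupType).
Variable mu : probability (borel G) R.
Hypothesis Gc : compact [set: G].
Implicit Types (u v : G -> R) (F : G -> G -> R).
Local Notation mean := (haar_mean mu).

(* Functions on [G * G] that are finite sums of products [u g * v h]: their two
   iterated means agree without any product measure on [G * G]. *)
Inductive separated : (G -> G -> R) -> Prop :=
| Separated_mul u v : continuous u -> continuous v ->
    separated (fun g h => u g * v h)
| Separated_add F1 F2 : separated F1 -> separated F2 ->
    separated (fun g h => F1 g h + F2 g h).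

Lemma continuousM_real (T : topologicalType) (u v : T -> R) :
  continuous u -> continuous v -> continuous (fun x => u x * v x).
Proof. by move=> cu cv x; apply: cvgM; [exact: cu|exact: cv]. Qed.

Lemma continuousD_real (T : topologicalType) (u v : T -> R) :
  continuous u -> continuous v -> continuous (fun x => u x + v x).
Proof. by move=> cu cv x; apply: cvgD; [exact: cu|exact: cv]. Qed.

Lemma continuous_cst_real (T : topologicalType) (k : R) : continuous
  (fun _ : T => k).
Proof. by move=> x; exact: cvg_cst. Qed.

Lemma separated_eq F1 F2 : (forall g h, F1 g h = F2 g h) ->
  separated F1 -> separated F2.
Proof. by move=> e; rewrite (_ : F2 = F1)//; apply/funext => g;
  apply/funext. Qed.

Lemma separated_l u : continuous u -> separated (fun g _ => u g).
Proof.
move=> cu; apply: (@separated_eq (fun g _ => u g * 1)); first by move=> *;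
  rewrite mulr1.
by apply: Separated_mul => //; exact: continuous_cst_real.
Qed.

Lemma separatedM F1 F2 : separated F1 -> separated F2 ->
  separated (fun g h => F1 g h * F2 g h).
Proof.
move=> s1 s2; elim: s1 => [u v cu cv|F F' _ IH _ IH'].
  elim: s2 => [u' v' cu' cv'|F F' _ IH _ IH'].
    apply: (@separated_eq (fun g h => (u g * u' g) * (v h * v' h))).
      by move=> g h; rewrite mulrACA.
    by apply: Separated_mul; exact: continuousM_real.
  apply: (separated_eq _ (Separated_add IH IH')) => g h.
  by rewrite mulrDr.
apply: (separated_eq _ (Separated_add IH IH')) => g h.
by rewrite mulrDl.
Qed.

Lemma separatedZ (k : R) F : separated F -> separated (fun g h => k * F g h).
Proof. by apply: separatedM; apply: separated_l;
  exact: continuous_cst_real. Qed.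

Lemma separatedB F1 F2 : separated F1 -> separated F2 ->
  separated (fun g h => F1 g h - F2 g h).
Proof.
move=> s1 s2; apply: (separated_eq _ (Separated_add s1 (separatedZ (-1) s2))).
by move=> g h; rewrite mulN1r.
Qed.

Lemma separatedX F n : separated F -> separated (fun g h => F g h ^+ n).
Proof.
move=> sF; elim: n => [|n IH]; first by apply: separated_l;
  exact: continuous_cst_real.
by apply: (separated_eq _ (separatedM sF IH)) => g h; rewrite exprS.
Qed.

Lemma separated_sum (I : Type) (s : seq I) (F : I -> G -> G -> R) :
  (forall i, separated (F i)) -> separated (fun g h => \sum_(i <- s) F i g h).
Proof.
move=> sF; elim: s => [|i s IH].
  apply: (@separated_eq (fun _ _ => 0)); first by move=> *; rewrite big_nil.
  by apply: separated_l; exact: continuous_cst_real.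
by apply: (separated_eq _ (Separated_add (sF i) IH)) => g h; rewrite big_cons.
Qed.

Lemma separated_contl F h : separated F -> continuous (fun g => F g h).
Proof.
elim=> [u v cu cv|F1 F2 _ c1 _ c2]; last exact: continuousD_real.
by apply: continuousM_real => //; exact: continuous_cst_real.
Qed.

Lemma separated_contr F g : separated F -> continuous (F g).
Proof.
elim=> [u v cu cv|F1 F2 _ c1 _ c2]; last exact: continuousD_real.
by apply: continuousM_real => //; exact: continuous_cst_real.
Qed.

Lemma separated_mean F : separated F ->
  [/\ continuous (fun g => mean (F g)),
      continuous (fun h => mean (fun g => F g h)) &
      mean (fun g => mean (F g)) = mean (fun h => mean (fun g => F g h))].
Proof.
elim=> [u v cu cv|F1 F2 s1 [c1 c1' e1] s2 [c2 c2' e2]].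
  have -> : (fun g => mean (fun h => u g * v h)) = fun g => u g * mean v.
    by apply/funext => g; rewrite (meanZ mu Gc).
  have -> : (fun h => mean (fun g => u g * v h)) = fun h => v h * mean u.
    apply/funext => h; rewrite -(meanZ mu Gc)//; congr mean.
    by apply/funext => g; rewrite mulrC.
  split; try by apply: continuousM_real => //; exact: continuous_cst_real.
  by rewrite !(meanZr mu Gc)// mulrC.
have -> : (fun g => mean (fun h => F1 g h + F2 g h)) =
    fun g => mean (F1 g) + mean (F2 g).
  apply/funext => g.
  exact: (meanD mu Gc (separated_contr s1) (separated_contr s2)).
have -> : (fun h => mean (fun g => F1 g h + F2 g h)) =
    fun h => mean (fun g => F1 g h) + mean (fun g => F2 g h).
  apply/funext => h.
  exact: (meanD mu Gc (separated_contl s1) (separated_contl s2)).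
split; try exact: continuousD_real.
by rewrite (meanD mu Gc c1 c2) (meanD mu Gc c1' c2') e1 e2.
Qed.

End Separated.

Section MeanBound.
Variables (R : realType) (G : topologicalGroupType).
Variable mu : probability (borel G) R.
Hypothesis Gc : compact [set: G].
Local Notation mean := (haar_mean mu).

(** Cauchy-Schwarz: with [m] the mean of [u * v], the square of [v - m * u] and [u ^+ 2 <= 1] give
    [v ^+ 2 >= 2 * m * (u * v) - m ^+ 2], of mean [m ^+ 2]. *)
Lemma mean_mul_le (u v : G -> R) : (forall x, `|u x| <= 1) ->
  continuous u -> continuous v ->
  `|mean (fun x => u x * v x)| <= Num.sqrt (mean (fun x => v x ^+ 2)).
Proof.
move=> u1 cu cv.
have cv2 : continuous (fun x => v x ^+ 2).
  rewrite (_ : (fun _ => _) = fun x => v x * v x);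
    first exact: continuousM_real.
  by apply/funext => x; rewrite expr2.
have cuv : continuous (fun x => u x * v x) by exact: continuousM_real.
set m := mean (fun x => u x * v x).
rewrite -sqrtr_sqr; apply: ler_wsqrtr.
have : 0 <= mean (fun x => v x ^+ 2 - (2 * m * (u x * v x) - m ^+ 2)).
  rewrite -[leLHS](mean_cst mu); apply: (mean_le mu Gc).
  - exact: continuous_cst_real.
  - move=> x; apply: cvgB; first exact: cv2.
    apply: cvgB; last exact: cvg_cst.
    by apply: cvgM; [exact: cvg_cst|exact: cuv].
  - move=> x.
    have u2 : u x ^+ 2 <= 1.
      by rewrite -[leRHS](expr1n _ 2) -[leLHS]real_normK ?num_real//
        lerXn2r ?nnegrE.
    have : 0 <= (v x - m * u x) ^+ 2 by exact: sqr_ge0.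
    have : 0 <= m ^+ 2 * (1 - u x ^+ 2) by rewrite mulr_ge0 ?sqr_ge0// subr_ge0.
    by lra.
have c1 : continuous (fun x => 2 * m * (u x * v x)).
  by apply: continuousM_real => //; exact: continuous_cst_real.
have c2 : continuous (fun x => 2 * m * (u x * v x) - m ^+ 2).
  by move=> x; apply: cvgB; [exact: c1|exact: cvg_cst].
rewrite (meanB mu Gc cv2 c2) (meanB mu Gc c1 (@continuous_cst_real _ _ _)).
by rewrite (meanZ mu Gc _ cuv) mean_cst -/m; lra.
Qed.

End MeanBound.

Section ExchangeablePair.
Variables (R : realType) (G : topologicalGroupType).
Variable mu : probability (borel G) R.
Hypothesis Gc : compact [set: G].
Hypothesis muL : haar mu.
Local Notation mean := (haar_mean mu).
Variables (W : G -> R) (alpha : G) (a : R).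
Hypothesis cW : continuous W.
Hypothesis alpha_conj : exists h : G, (alpha^-1 = h * alpha * h^-1)%g.

(* If [alpha^-1 = k * alpha * k^-1] then [(cj h)^-1 = cj (k^-1 * h)]: inverting
   [cj h] is a left translation of [h], so left invariance of [mu] suffices. *)
Let cj (h : G) : G := (h^-1 * alpha * h)%g.
Definition conj_shift (g h : G) : R := W (cj h * g)%g.
Local Notation W' := conj_shift.

Hypothesis sW' : separated W'.
Hypothesis regression : forall g, mean (W' g) = (1 - a) * W g.

(** The mean over [g] is the inner one: for fixed [h] it is preserved by the translation by [cj h].
    Conditioning on [g] needs the other order. *)
Definition mean2 (F : G -> G -> R) : R := mean (fun h => mean (fun g => F g h)).

Lemma mean2D F1 F2 : separated F1 -> separated F2 ->
  mean2 (fun g h => F1 g h + F2 g h) = mean2 F1 + mean2 F2.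
Proof.
move=> s1 s2; have [_ c1 _] := separated_mean mu Gc s1.
have [_ c2 _] := separated_mean mu Gc s2.
rewrite /mean2 -(meanD mu Gc c1 c2).
congr mean; apply/funext => h.
exact: (meanD mu Gc (separated_contl s1) (separated_contl s2)).
Qed.

Lemma mean2Z k F : separated F -> mean2 (fun g h => k * F g h) = k * mean2 F.
Proof.
move=> s; rewrite /mean2 -(meanZ mu Gc); last by case: (separated_mean mu Gc s).
congr mean; apply/funext => h; exact: (meanZ mu Gc k (separated_contl s)).
Qed.

Lemma mean2_le F1 F2 : separated F1 -> separated F2 ->
  (forall g h, F1 g h <= F2 g h) -> mean2 F1 <= mean2 F2.
Proof.
move=> s1 s2 F12; have [_ c1 _] := separated_mean mu Gc s1.
have [_ c2 _] := separated_mean mu Gc s2.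
apply: (mean_le mu Gc c1 c2) => h.
exact: (mean_le mu Gc (separated_contl s1) (separated_contl s2)).
Qed.

Let sl (u : G -> R) : continuous u -> separated (fun g _ => u g).
Proof. exact: separated_l. Qed.

Let kD (k : G -> R) g h := k g * (W g - W' g h).

Let skD k : continuous k -> separated (kD k).
Proof.
by move=> ck; apply: separatedM; [exact: sl|apply: separatedB => //; exact: sl].
Qed.

(** The order of the means is swapped so that [regression] applies to the one over [h]. *)
Let mean2_kD k : continuous k -> mean2 (kD k) = a * mean (fun g => k g * W g).
Proof.
move=> ck; have [_ _ E] := separated_mean mu Gc (skD ck).
rewrite /mean2 -E -(meanZ mu Gc); last exact: continuousM_real.
congr mean; apply/funext => g.
rewrite (meanZ mu Gc _ (separated_contr (separatedB (sl cW) sW'))).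
rewrite (meanB mu Gc (@continuous_cst_real _ _ _) (separated_contr sW')).
by rewrite mean_cst regression; ring.
Qed.

Lemma continuous_translate (k : G -> R) g :
  continuous k -> continuous (fun x => k (g * x)%g).
Proof.
move=> ck x; apply: (@continuous_comp _ _ _ (fun x => (g * x)%g) k);
  [exact: continuous_mulgl|exact: ck].
Qed.

(* Translating [g] by [(cj h)^-1] exchanges the roles of [W g] and [W' g h]. *)
Lemma exchange (k : G -> R) : continuous k ->
  continuous (fun h => mean
    (fun g => (k (cj h * g)%g - k g) * (W' g h - W g))) /\
  mean2 (fun g h => (k (cj h * g)%g - k g) * (W' g h - W g)) =
  2 * a * mean (fun g => k g * W g).
Proof.
move=> ck; have [h0 ah0] := alpha_conj.
have cjV h : ((cj h)^-1 = cj (h0^-1 * h))%g.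
  by rewrite /cj !invgM !invgK ah0 !mulgA.
pose A h := mean (fun g => kD k g h).
have cA : continuous A by case: (separated_mean mu Gc (skD ck)).
have E h : mean (fun g => (k (cj h * g)%g - k g) * (W' g h - W g)) =
    A h + A (h0^-1 * h)%g.
  have -> : A (h0^-1 * h)%g = - mean (fun g => k (cj h * g)%g * (W g - W' g h)).
    rewrite -(mean_mulgl Gc muL ((cj h)^-1)%g
      (f := fun g => k (cj h * g)%g * (W g - W' g h))); last first.
      apply: continuousM_real; first exact: continuous_translate.
      exact: (separated_contl (separatedB (sl cW) sW')).
    rewrite -[RHS]mulN1r -(meanZ mu Gc); last first.
      apply: (@continuous_translate (fun g => k (cj h * g)%g * (W g - W' g h))).
      apply: continuousM_real; first exact: continuous_translate.
      exact: (separated_contl (separatedB (sl cW) sW')).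
    rewrite /A; congr mean; apply/funext => g;
      rewrite /kD /conj_shift -cjV mulVKg; ring.
  rewrite /A -(meanB mu Gc); first last.
  - apply: continuousM_real; first exact: continuous_translate.
    exact: (separated_contl (separatedB (sl cW) sW')).
  - exact: (separated_contl (skD ck)).
  congr mean; apply/funext => g; rewrite /kD; ring.
have Efun : (fun h => mean (fun g => (k (cj h * g)%g - k g) * (W' g h - W g))) =
    (fun h => A h + A (h0^-1 * h)%g) by apply/funext => h; exact: E.
(* For an arbitrary [k] the integrand need not be [separated]; its continuity in [h] is read off
   [Efun]. *)
split.
  by rewrite Efun; apply: continuousD_real => //; exact: continuous_translate.
rewrite /mean2 Efun (meanD mu Gc)//; last exact: continuous_translate.
rewrite (mean_mulgl Gc muL h0^-1%g cA).
have -> : mean A = a * mean (fun g => k g * W g) by exact: mean2_kD.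
ring.
Qed.

Let sd : separated (fun g h => W' g h - W g).
Proof. by apply: separatedB => //; exact: sl. Qed.

Lemma mean2_sqr :
  mean2 (fun g h => (W' g h - W g) ^+ 2) = 2 * a * mean (fun g => W g ^+ 2).
Proof.
have [_] := exchange cW.
rewrite (_ : (fun g h => _) = fun g h => (W' g h - W g) ^+ 2); last first.
  by apply/funext => g; apply/funext => h; rewrite expr2.
by move=> ->.
Qed.

Let cX (T : topologicalType) (k : T -> R) n :
  continuous k -> continuous (fun g => k g ^+ n).
Proof.
move=> ck; elim: n => [|n IH]; first exact: continuous_cst_real.
rewrite (_ : (fun g => _) = fun g => k g * k g ^+ n);
  first exact: continuousM_real.
by apply/funext => g; rewrite exprS.
Qed.

Lemma mean2_W'X n : mean2 (fun g h => W' g h ^+ n) = mean (fun g => W g ^+ n).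
Proof.
rewrite /mean2 -[RHS](mean_cst mu); congr mean; apply/funext => h.
by apply: (mean_mulgl Gc muL (cj h) (f := fun g => W g ^+ n)); exact: cX.
Qed.

(** The fourth power is [4 * (W' ^+ 3 - W ^+ 3) * (W' - W)] minus [3 * W' ^+ 4 + 3 * W ^+ 4] plus
    [6 * W ^+ 2 * W' ^+ 2]; [exchange] for [W ^+ 3] evaluates the first term. *)
Lemma mean2_pow4 : mean2 (fun g h => (W' g h - W g) ^+ 4) =
  (8 * a - 6) * mean (fun g => W g ^+ 4) +
  6 * mean (fun g => W g ^+ 2 * mean (fun h => W' g h ^+ 2)).
Proof.
have [_] := exchange (@cX _ W 3 cW).
set X := mean2 _ => XE.
have sX : separated (fun g h => (W' g h ^+ 3 - W g ^+ 3) * (W' g h - W g)).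
  apply: separatedM => //; apply: separatedB; first exact: separatedX.
  by apply: sl; exact: cX.
have s22 : separated (fun g h => W g ^+ 2 * W' g h ^+ 2).
  by apply: separatedM; [apply: sl; exact: cX|exact: separatedX].
have sW4 : separated (fun g _ : G => W g ^+ 4) by apply: sl; exact: cX.
have sW'2 : separated (fun g h => W' g h ^+ 2) by exact: separatedX.
have sW'4 : separated (fun g h => W' g h ^+ 4) by exact: separatedX.
have -> : (fun g h => (W' g h - W g) ^+ 4) = fun g h =>
    4 * ((W' g h ^+ 3 - W g ^+ 3) * (W' g h - W g)) + (-3 * W' g h ^+ 4 +
    (-3 * W g ^+ 4 + 6 * (W g ^+ 2 * W' g h ^+ 2))).
  by apply/funext => g; apply/funext => h; ring.
rewrite mean2D; [|exact: separatedZ|]; last first.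
  by apply: Separated_add; [exact: separatedZ|apply: Separated_add;
    exact: separatedZ].
rewrite mean2D; [|exact: separatedZ|apply: Separated_add; exact: separatedZ].
rewrite mean2D; [|exact: separatedZ|exact: separatedZ].
rewrite !mean2Z// mean2_W'X -/X XE.
have -> : mean2 (fun g _ => W g ^+ 4) = mean (fun g => W g ^+ 4).
  by rewrite /mean2 mean_cst.
have -> : mean2 (fun g h => W g ^+ 2 * W' g h ^+ 2) =
    mean (fun g => W g ^+ 2 * mean (fun h => W' g h ^+ 2)).
  have [_ _ E] := separated_mean mu Gc s22; rewrite /mean2 -E; congr mean;
    apply/funext => g.
  exact: (meanZ mu Gc _ (separated_contr sW'2)).
have -> : mean (fun g => W g ^+ 3 * W g) = mean (fun g => W g ^+ 4).
  by congr mean; apply/funext => g; rewrite -exprSr.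
ring.
Qed.

Hypothesis a_gt0 : 0 < a.
Hypothesis W_var : mean (fun g => W g ^+ 2) = 1.

Definition cond_sqr g := mean (fun h => (W' g h - W g) ^+ 2).

Let s2 : separated (fun g h => (W' g h - W g) ^+ 2).
Proof. exact: separatedX. Qed.
Let s4 : separated (fun g h => (W' g h - W g) ^+ 4).
Proof. exact: separatedX. Qed.

Lemma cond_sqrE g :
  cond_sqr g = mean (fun h => W' g h ^+ 2) + (2 * a - 1) * W g ^+ 2.
Proof.
have sW'2 : separated (fun g h => W' g h ^+ 2) by exact: separatedX.
rewrite /cond_sqr (_ : (fun h => _) =
    fun h => W' g h ^+ 2 + (- 2 * W g * W' g h + W g ^+ 2)); last first.
  by apply/funext => h; ring.
have c1 : continuous (fun h => - 2 * W g * W' g h).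
  exact: (continuousM_real (@continuous_cst_real _ _ _) (separated_contr sW')).
have c0 := @continuous_cst_real R G (W g ^+ 2).
rewrite (meanD mu Gc (separated_contr sW'2) (continuousD_real c1 c0)).
rewrite (meanD mu Gc c1 c0) (meanZ mu Gc _ (separated_contr sW')) mean_cst.
by rewrite regression; ring.
Qed.

Lemma continuous_cond_sqr : continuous cond_sqr.
Proof. by have [] := separated_mean mu Gc s2. Qed.

(** The inequality of arithmetic and geometric means, with a weight [s] left free for
    [normal_approx] to optimize. *)
Lemma cube_le (x s : R) : 0 < s ->
  `|x| * x ^+ 2 <= s / 2 * x ^+ 2 + (2 * s)^-1 * x ^+ 4.
Proof.
move=> s0; rewrite -subr_ge0.
have -> : s / 2 * x ^+ 2 + (2 * s)^-1 * x ^+ 4 - `|x| * x ^+ 2 =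
  (2 * s)^-1 * x ^+ 2 * (s - `|x|) ^+ 2.
  have xx : `|x| ^+ 2 = x ^+ 2 by rewrite real_normK ?num_real.
  have s00 : s != 0 by rewrite gt_eqF.
  rewrite [in RHS]sqrrB xx; field; rewrite ?s00//.
do 2 ?[apply: mulr_ge0; last exact: sqr_ge0].
by rewrite invr_ge0 mulr_ge0// ltW.
Qed.

Lemma stein_exchange (b c s : R) : b < c -> 0 < s ->
  `|mean (fun g => ramp b c (W g)) - ramp_p b c| <=
  Num.sqrt (mean (fun g => (1 - (2 * a)^-1 * cond_sqr g) ^+ 2)) +
  (4 * a * (c - b))^-1 *
    (s * a + (2 * s)^-1 * mean2 (fun g h => (W' g h - W g) ^+ 4)).
Proof.
move=> bc s0.
pose f := stein b c; pose f' := stein' b c.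
have cf : continuous (fun g => f (W g)).
  move=> x; apply: (@continuous_comp _ _ _ W f); first exact: cW.
  exact: continuous_stein.
have cf' : continuous (fun g => f' (W g)).
  move=> x; apply: (@continuous_comp _ _ _ W f'); first exact: cW.
  exact: continuous_stein'.
have cr : continuous (fun g => ramp b c (W g)).
  move=> x; apply: (@continuous_comp _ _ _ W (ramp b c)); first exact: cW.
  exact: continuous_ramp.
have [cQ QE] := exchange cf.
set E4 := mean2 _.
have d0 : 0 < c - b by rewrite subr_gt0.
have sP : separated (fun g h => f' (W g) * (W' g h - W g) ^+ 2).
  by apply: separatedM => //; exact: sl.
pose k := (2 * (c - b))^-1.
have k0 : 0 < k by rewrite invr_gt0 mulr_gt0.
(* A majorant of the Taylor remainder that is polynomial in [W] and [W'], hence [separated]. *)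
pose Rm g h := k * (s / 2 * (W' g h - W g) ^+ 2 + (2 * s)^-1 *
  (W' g h - W g) ^+ 4).
have sR : separated Rm.
  by apply: separatedZ; apply: Separated_add; exact: separatedZ.
have RE : mean2 Rm = k * (s * a + (2 * s)^-1 * E4).
  rewrite /Rm mean2Z; last by apply: Separated_add; exact: separatedZ.
  rewrite mean2D; [|exact: separatedZ|exact: separatedZ].
  rewrite !mean2Z// mean2_sqr W_var -/E4; congr (_ * (_ + _)).
  by field.
have remP g h : `|(f (W' g h) - f (W g)) * (W' g h - W g) -
    f' (W g) * (W' g h - W g) ^+ 2| <= Rm g h.
  have T := stein_taylor bc (W g) (W' g h).
  set D := W' g h - W g in T *.
  have -> : (f (W' g h) - f (W g)) * D - f' (W g) * D ^+ 2 =
     (f (W' g h) - f (W g) - f' (W g) * D) * D by ring.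
  rewrite normrM; apply: (@le_trans _ _ (k * (`|D| * D ^+ 2))).
    have -> : k * (`|D| * D ^+ 2) =
      D ^+ 2 / (2 * (c - b)) * `|D| by rewrite /k; ring.
    by rewrite ler_wpM2r.
  by rewrite /Rm -/D ler_wpM2l ?(ltW k0)// cube_le.
have [_ cP EP] := separated_mean mu Gc sP.
have [_ cR _] := separated_mean mu Gc sR.
have cT (h : G) : continuous (fun g => (f (W' g h) - f (W g)) * (W' g h - W g)).
  apply: continuousM_real; last exact: (separated_contl sd).
  move=> x; apply: cvgB; last exact: cf.
  exact: (continuous_translate (k := fun g => f (W g)) cf).
(* The term with [f (W' g h)] need not be [separated], so [mean2_le] does not apply: the comparison
   is made for each [h] first, then averaged. *)
have Qle h :
    mean (fun g => (f (W' g h) - f (W g)) * (W' g h - W g)) -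
    mean (fun g => f' (W g) * (W' g h - W g) ^+ 2) <= mean (fun g => Rm g h).
  rewrite -(meanB mu Gc (cT h) (separated_contl sP)); apply: (mean_le mu Gc).
  - by move=> x; apply: cvgB; [exact: cT|exact: (separated_contl sP)].
  - exact: (separated_contl sR).
  - by move=> g; have := remP g h; rewrite ler_norml => /andP[].
have Qge h :
    mean (fun g => f' (W g) * (W' g h - W g) ^+ 2) -
    mean (fun g => (f (W' g h) - f (W g)) * (W' g h - W g)) <=
      mean (fun g => Rm g h).
  rewrite -(meanB mu Gc (separated_contl sP) (cT h)); apply: (mean_le mu Gc).
  - by move=> x; apply: cvgB; [exact: (separated_contl sP)|exact: cT].
  - exact: (separated_contl sR).
  - by move=> g; have /ler_normlP[+ _] := remP g h; rewrite opprB.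
pose Q := mean2 (fun g h => (f (W' g h) - f (W g)) * (W' g h - W g)).
pose P := mean2 (fun g h => f' (W g) * (W' g h - W g) ^+ 2).
have QP : `|Q - P| <= mean2 Rm.
  rewrite ler_norml; apply/andP; split.
    rewrite lerNl opprB -(meanB mu Gc cP cQ).
    by apply: (mean_le mu Gc _ cR Qge) => x; apply: cvgB; [exact: cP|exact: cQ].
  rewrite -(meanB mu Gc cQ cP).
  by apply: (mean_le mu Gc _ cR Qle) => x; apply: cvgB; [exact: cQ|exact: cP].
have PE : P = mean (fun g => f' (W g) * cond_sqr g).
  rewrite /P /mean2 -EP; congr mean; apply/funext => g.
  exact: (meanZ mu Gc _ (separated_contr s2)).
pose V g := 1 - (2 * a)^-1 * cond_sqr g.
have cV : continuous V.
  move=> x; apply: cvgB; first exact: cvg_cst.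
  by apply: cvgM; [exact: cvg_cst|exact: continuous_cond_sqr].
have a0 : a != 0 by rewrite gt_eqF.
(* By Stein's equation the left side is the mean of [f' (W g) - f (W g) * W g], where [exchange]
   turns the second part into [Q / (2 * a)]; replacing [Q] by [P] leaves the factor [V]. *)
have main : mean (fun g => ramp b c (W g)) - ramp_p b c =
    mean (fun g => f' (W g) * V g) + (2 * a)^-1 * (P - Q).
  have cfW : continuous (fun g => f (W g) * W g)
    by exact: (continuousM_real cf cW).
  have cfs : continuous (fun g => f' (W g) * cond_sqr g).
    exact: (continuousM_real cf' continuous_cond_sqr).
  have -> : mean (fun g => f' (W g) * V g) =
      mean (fun g => f' (W g)) - (2 * a)^-1 * P.
    rewrite PE -(meanZ mu Gc _ cfs) -(meanB mu Gc cf').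
      by congr mean; apply/funext => g; rewrite /V; ring.
    exact: (continuousM_real (@continuous_cst_real _ _ _) cfs).
  have -> : Q = 2 * a * mean (fun g => f (W g) * W g) by exact: QE.
  rewrite -{1}(mean_cst mu (ramp_p b c)) -(meanB mu Gc cr
    (@continuous_cst_real _ _ _)).
  rewrite (_ : (fun g => _) = fun g => f' (W g) - f (W g) * W g); last first.
    by apply/funext => g; rewrite (stein_eq b c) mulrC.
  rewrite (meanB mu Gc cf' cfW); field; rewrite ?a0//.
rewrite main; apply: (le_trans (ler_normD _ _)); apply: lerD; last first.
  rewrite normrM distrC gtr0_norm ?invr_gt0 ?mulr_gt0//.
  apply: (le_trans (ler_wpM2l _ QP)); first by rewrite invr_ge0 mulr_ge0// ltW.
  rewrite RE /k le_eqVlt; apply/orP; left; apply/eqP.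
  have : c - b != 0 by rewrite gt_eqF.
  have : s != 0 by rewrite gt_eqF.
  by move=> h1 h2; field; rewrite ?h1 ?h2 ?a0.
have f'1 g : `|f' (W g)| <= 1 by exact: stein'_le1.
exact: (mean_mul_le mu Gc f'1 cf' cV).
Qed.

(** The indicator is squeezed between the ramps over [x0 - d, x0] and [x0, x0 + d]; [0 < S] keeps
    the width [d] positive. *)
Lemma normal_approx (S x0 : R) : 0 < S ->
  mean2 (fun g h => (W' g h - W g) ^+ 4) = a * S ->
  `|fine (mu [set g | W g <= x0]) - gauss_cdf x0| <=
  Num.sqrt (mean (fun g => (1 - (2 * a)^-1 * cond_sqr g) ^+ 2)) +
  (pi^-1 * S) `^ (4^-1).
Proof.
move=> S0 E4; set V := Num.sqrt _; set q := _ `^ _.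
have pi0 : 0 < pi :> R by exact: pi_gt0.
have q0 : 0 < q by rewrite powR_gt0// mulr_gt0// invr_gt0.
have q4 : q ^+ 4 = pi^-1 * S.
  rewrite -powR_mulrn ?(ltW q0)// -powRrM mulVf// powRr1//.
  by apply: mulr_ge0; [rewrite invr_ge0|]; exact: ltW.
set sp := Num.sqrt (2 * pi) : R.
have sp0 : 0 < sp by exact: sqrt2pi_gt0.
have sp2 : sp ^+ 2 = 2 * pi by rewrite sqr_sqrtr// mulr_ge0// ltW.
have SE : S = sp ^+ 2 * q ^+ 4 / 2.
  have pi00 : pi != 0 :> R by rewrite gt_eqF.
  by rewrite q4 sp2 -[2 * pi * _]mulrA mulVKf// mulrAC mulfV ?mul1r.
(* These values minimize the sum of the smoothing error [d / sp] and of the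
   Taylor error [errE] below; at the minimum both equal [q / 2]. *)
pose d := q * sp / 2; pose s := sp * q ^+ 2 / 2.
have d0 : 0 < d by rewrite divr_gt0// mulr_gt0.
have s0 : 0 < s by rewrite divr_gt0// mulr_gt0// exprn_gt0.
have sp00 : sp != 0 by rewrite gt_eqF.
have q00 : q != 0 by rewrite gt_eqF.
have a00 : a != 0 by rewrite gt_eqF.
have errE : (4 * a * d)^-1 * (s * a + (2 * s)^-1 * (a * S)) = q / 2.
  by rewrite SE /s /d; field; rewrite ?sp00 ?q00 ?a00.
have dE : d / sp = q / 2 by rewrite /d; field; rewrite ?sp00.
have bound b c : c - b = d ->
    `|mean (fun g => ramp b c (W g)) - ramp_p b c| <= V + q / 2.
  move=> cb; have bc : b < c by rewrite -subr_gt0 cb.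
  by have := stein_exchange bc s0; rewrite E4 cb errE.
have cr b c : continuous (fun g => ramp b c (W g)).
  move=> x; apply: (@continuous_comp _ _ _ W (ramp b c)); first exact: cW.
  exact: continuous_ramp.
rewrite ler_norml; apply/andP; split.
- have cb : x0 - (x0 - d) = d by ring.
  have bc : x0 - d < x0 by rewrite ltrBlDr ltrDl.
  have := bound _ _ cb; rewrite ler_norml => /andP[h1 _].
  have /andP[h2 _] := ramp_p_bounds bc.
  have h3 : mean (fun g => ramp (x0 - d) x0 (W g)) <= fine (mu [set g | W g <=
    x0]).
    apply: (mean_le_prob mu Gc cW (cr _ _)) => g; first exact: ramp_le1.
    by move=> xW; rewrite ramp_r.
  have := gauss_cdf_lip (ltW bc); rewrite cb -/sp dE => h4.
  lra.
- have cb : x0 + d - x0 = d by ring.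
  have bc : x0 < x0 + d by rewrite ltrDl.
  have := bound _ _ cb; rewrite ler_norml => /andP[_ h1].
  have /andP[_ h2] := ramp_p_bounds bc.
  have h3 : fine (mu [set g | W g <= x0]) <=
    mean (fun g => ramp x0 (x0 + d) (W g)).
    apply: (prob_le_mean mu Gc cW (cr _ _)) => g; first exact: ramp_ge0.
    by move=> xW; rewrite ramp_l.
  have := gauss_cdf_lip (ltW bc); rewrite cb -/sp dE => h4.
  lra.
Qed.

End ExchangeablePair.

(** * Expansions in characters *)

Section CharacterExpansion.
Variables (R : realType) (G : topologicalGroupType).
Variable mu : probability (borel G) R.
Hypothesis Gc : compact [set: G].
Hypothesis muL : haar mu.
Local Notation C := R[i].
Local Notation mean := (haar_mean mu).
Local Notation cmean := (haar_cmean mu).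
Implicit Types (phi psi tau rho : rep R G) (F : G -> R) (b : rep R G -> R).

Lemma cmeanR F : cmean (fun g => (F g)%:C%C) = (mean F)%:C%C.
Proof. by rewrite /haar_cmean /= mean_cst. Qed.

(** The character takes conjugate values at [alpha] and its inverse, and equal ones as they are
    conjugate in [G]. *)
Lemma char_ratioE phi alpha : (exists h : G, (alpha^-1 = h * alpha * h^-1)%g) ->
  (char_ratio phi alpha)%:C%C = rep_char phi alpha / (rep_dim phi)%:R.
Proof.
move=> [h ah]; rewrite /char_ratio RRe_real//.
apply: realM; last by rewrite realV realn.
by apply/CrealP; rewrite -(rep_charV Gc muL) ah rep_char_J.
Qed.

Lemma ccont_char_cj phi alpha g :
  ccont (fun h => rep_char phi (h^-1 * alpha * h * g)%g).
Proof.
have -> : (fun h => rep_char phi (h^-1 * alpha * h * g)%g) =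
    fun h => \tr (phi (h^-1)%g *m phi alpha *m phi h *m phi g).
  by apply/funext => h; rewrite /rep_char !rep_M.
apply: ccont_sum => i; apply: mx_continuous_mul; last exact: mx_continuous_cst.
apply: mx_continuous_mul; last exact: rep_continuous.
apply: mx_continuous_mul; last exact: mx_continuous_cst.
exact/mx_continuousV/rep_continuous.
Qed.

(** The complex conjugate of an idempotent commuting with [rep_conj tau] commutes with [tau], so it
    is a scalar, equal to 0 or 1. *)
Lemma rep_conj_irr tau : rep_irreducible tau -> rep_irreducible (rep_conj tau).
Proof.
move=> irr; apply: contrapT => nirr; have [tau0 _] := irr.
have [p [[pp pc] p0 p1]] :=
  @reducible_idem R G mu Gc muL (rep_conj tau) tau0 nirr.
have conjK n (A : 'M[C]_n) : map_mx Num.conj (map_mx Num.conj A) = A.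
  by apply/matrixP => i j; rewrite !mxE conjCK.
have [|x xE] := @schur_scalar R G tau (map_mx Num.conj p) irr.
  move=> g; rewrite -[tau g]conjK -!map_mxM; congr map_mx; exact: pc.
have pE : p = (x^*)%:M by rewrite -[p]conjK xE map_scalar_mx.
have xx : x^* * x^* = x^*.
  move: pp; rewrite pE mul_scalar_mx scale_scalar_mx.
  by move=> /matrixP/(_ (Ordinal tau0) (Ordinal tau0));
    rewrite !mxE eqxx !mulr1n.
have : x^* * (x^* - 1) == 0 by rewrite mulrBr mulr1 xx subrr.
rewrite mulf_eq0 subr_eq0 => /orP[] /eqP xv; [apply: p0|apply: p1];
  rewrite pE xv //.
by rewrite scalemx0 || exact: raddf0.
Qed.

Lemma rep_triv_irr : rep_irreducible (@rep_triv R G).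
Proof.
split => // U _.
have dT : \dim (fullv : {vspace 'cV[C]_1}) = 1%N by rewrite dimvf.
have [U0|U0] := eqVneq U 0%VS; [by left|right].
apply/eqP; rewrite eqEdim subvf /= dT lt0n dimv_eq0//.
Qed.

Lemma rep_char_triv g : rep_char (@rep_triv R G) g = 1.
Proof. by rewrite /rep_char mxtrace1. Qed.

Definition expands (s : seq (rep R G)) F b :=
  forall g, (F g)%:C%C = \sum_(phi <- s) (b phi)%:C%C * rep_char phi g.

Lemma expandsD s F1 F2 b1 b2 : expands s F1 b1 -> expands s F2 b2 ->
  expands s (fun g => F1 g + F2 g) (fun phi => b1 phi + b2 phi).
Proof.
move=> e1 e2 g; rewrite rmorphD /= e1 e2 -big_split; apply: eq_bigr => phi _.
by rewrite rmorphD /= mulrDl.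
Qed.

Lemma expandsZ s k F b : expands s F b ->
  expands s (fun g => k * F g) (fun phi => k * b phi).
Proof.
move=> e g; rewrite rmorphM /= e mulr_sumr; apply: eq_bigr => phi _.
by rewrite rmorphM /= mulrA.
Qed.

(** As [F2] and its coefficients are real, the characters in its expansion may be conjugated, which
    produces the pairing of [char_ortho]. *)
Lemma parseval s F1 F2 b1 b2 :
  uniq s -> (forall phi, phi \in s -> irr_reps phi) ->
  expands s F1 b1 -> expands s F2 b2 ->
  mean (fun g => F1 g * F2 g) = \sum_(phi <- s) b1 phi * b2 phi.
Proof.
move=> us sirr e1 e2; apply: (@complexI R); rewrite -cmeanR.
have -> : (fun g => (F1 g * F2 g)%:C%C) = fun g =>
    \sum_(phi <- s) \sum_(psi <- s)
      (b1 phi * b2 psi)%:C%C * (rep_char phi g * (rep_char psi g)^*).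
  apply/funext => g; rewrite rmorphM /= e1.
  have -> : (F2 g)%:C%C = \sum_(psi <- s) (b2 psi)%:C%C * (rep_char psi g)^*.
    have : ((F2 g)%:C%C)^* = (F2 g)%:C%C by exact: conjc_real.
    move=> <-; rewrite e2 rmorph_sum; apply: eq_bigr => psi _.
    by rewrite rmorphM; congr (_ * _); exact: conjc_real.
  rewrite big_distrlr; apply: eq_bigr => phi _; apply: eq_bigr => psi _.
  by rewrite rmorphM /= mulrACA.
have cc phi psi : ccont (fun g => (b1 phi * b2 psi)%:C%C * (rep_char phi g *
  (rep_char psi g)^*)).
  apply: ccontM; first exact: ccont_cst.
  by apply: ccontM; [exact: ccont_char|apply: ccont_conj; exact: ccont_char].
rewrite (cmean_sum mu Gc); last by move=> phi; apply: ccont_sum => psi;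
  exact: cc.
rewrite rmorph_sum big_seq [RHS]big_seq; apply: eq_bigr => phi ps.
rewrite (cmean_sum mu Gc); last by move=> psi; exact: cc.
rewrite (bigD1_seq phi)//= big_seq_cond big1 => [|psi /andP[qs qp]].
  rewrite addr0 (cmeanZ mu Gc); last first.
    by apply: ccontM; [exact: ccont_char|apply: ccont_conj; exact: ccont_char].
  rewrite (char_ortho Gc muL); [|exact: irr_reps_irr (sirr _ ps)..].
  by rewrite asboolT ?mulr1//; exact: rep_iso_refl.
rewrite (cmeanZ mu Gc); last first.
  by apply: ccontM; [exact: ccont_char|apply: ccont_conj; exact: ccont_char].
rewrite (char_ortho Gc muL);
  [|exact: irr_reps_irr (sirr _ ps)|exact: irr_reps_irr (sirr _ qs)].
rewrite asboolF ?mulr0// => iso; move/eqP : qp; apply.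
by apply/esym; apply: irr_reps_iso => //; exact: sirr.
Qed.

End CharacterExpansion.

(** * Moments of W and of the exchangeable pair *)

Section RealCharacter.
Variables (R : realType) (G : topologicalGroupType).
Variable mu : probability (borel G) R.
Hypothesis Gc : compact [set: G].
Hypothesis muL : haar mu.
Local Notation C := R[i].
Local Notation mean := (haar_mean mu).
Local Notation cmean := (haar_cmean mu).
Variables (tau : rep R G) (alpha : G).
Hypothesis tau_irr : rep_irreducible tau.
Hypothesis tau_nonreal : ~ (forall g : G, rep_char tau g \is Num.real).
Hypothesis alpha_conj : exists h : G, (alpha^-1 = h * alpha * h^-1)%g.

Definition rchar (g : G) : R := real_char_rv tau g.
Local Notation W := rchar.

Lemma rcharE g : W g = Num.sqrt 2 * complex.Re (rep_char tau g).
Proof.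
have e : Num.sqrt 2 * Num.sqrt 2 = 2 :> R by rewrite -expr2 sqr_sqrtr.
have n0 : Num.sqrt 2 != 0 :> R by rewrite gt_eqF// sqrtr_gt0.
rewrite /rchar /real_char_rv raddfD /=.
have -> : complex.Re ((rep_char tau g)^*) = complex.Re (rep_char tau g).
  by case: (rep_char tau g).
apply: (mulfI n0); rewrite mulrA mulfV// mul1r mulrA e; ring.
Qed.

Lemma continuous_rchar : continuous W.
Proof.
have -> : W = fun g => Num.sqrt 2 * complex.Re (rep_char tau g).
  by apply/funext => g; exact: rcharE.
move=> x; apply: cvgM; first exact: cvg_cst.
exact: (ccont_Re (@ccont_char R G tau)).
Qed.

Local Notation rho := (rep_exp (rep_dsum tau (rep_conj tau)) 2).

Lemma rep_char_square g : rep_char rho g = (2 * W g ^+ 2)%:C%C.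
Proof.
have -> : rep_char rho g = (rep_char tau g + (rep_char tau g)^*) ^+ 2.
  by rewrite [LHS]rep_char_tens rep_char_dsum rep_char_conj.
have -> : rep_char tau g + (rep_char tau g)^* =
  (2 * complex.Re (rep_char tau g))%:C%C.
  by case: (rep_char tau g) => u v; apply/eqP; rewrite eq_complex /=;
    apply/andP; split;
    apply/eqP; ring.
rewrite -rmorphXn; congr (_%:C%C); rewrite rcharE !exprMn sqr_sqrtr//; ring.
Qed.

Lemma tau_conj_niso : ~ rep_iso tau (rep_conj tau).
Proof.
move=> iso; apply: tau_nonreal => g; apply/CrealP.
by rewrite -rep_char_conj -(rep_char_iso iso).
Qed.

(** The squares of chi^tau and of its conjugate have mean 0, by orthogonality of [tau] to its
    conjugate; the cross term is twice a squared norm. This is also what gives [W] variance 1. *)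
Lemma cmean_square : cmean (rep_char rho) = 2.
Proof.
have cX := @ccont_char R G tau.
have cXJ := ccont_conj cX.
have cXX := ccontM cX cX; have cXXJ := ccontM cX cXJ.
have XX0 : cmean (fun g => rep_char tau g * rep_char tau g) = 0.
  rewrite (_ : (fun g => _) =
      fun g => rep_char tau g * (rep_char (rep_conj tau) g)^*); last first.
    by apply/funext => g; rewrite rep_char_conj conjCK.
  rewrite (char_ortho Gc muL)//; last exact: (rep_conj_irr Gc muL).
  by rewrite asboolF//; exact: tau_conj_niso.
have XJ : cmean (fun g => rep_char tau g * (rep_char tau g)^*) = 1.
  by rewrite (char_ortho Gc muL)// asboolT//; exact: rep_iso_refl.
have -> : rep_char rho = fun g =>
   (rep_char tau g * rep_char tau g + (rep_char tau g * rep_char tau g)^*) +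
   2 * (rep_char tau g * (rep_char tau g)^*).
  apply/funext => g; rewrite [LHS]rep_char_tens rep_char_dsum rep_char_conj
    rmorphM.
  ring.
rewrite (cmeanD mu Gc (ccontD cXX (ccont_conj cXX)) (ccontM
  (@ccont_cst _ _ _) cXXJ)).
rewrite (cmeanD mu Gc cXX (ccont_conj cXX)) (cmean_conj mu Gc cXX) XX0 rmorph0.
by rewrite (cmeanZ mu Gc _ cXXJ) XJ addr0 add0r mulr1.
Qed.

Lemma rchar_var : mean (fun g => W g ^+ 2) = 1.
Proof.
have cW2 : continuous (fun g => W g ^+ 2).
  rewrite (_ : (fun _ => _) = fun g => W g * W g); last first.
    by apply/funext => g; rewrite expr2.
  by apply: continuousM_real; exact: continuous_rchar.
have : (2 * mean (fun g => W g ^+ 2))%:C%C = 2 :> C.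
  rewrite -(meanZ mu Gc _ cW2) -cmeanR -[RHS]cmean_square; congr cmean.
  by apply/funext => g; rewrite rep_char_square.
have -> : 2 = (2 : R)%:C%C :> C by rewrite rmorph_nat.
by move=> /complexI; lra.
Qed.

Local Notation W' := (conj_shift W alpha).

(** The trace of a product of a matrix depending on [h] and one depending on [g] is a finite sum of
    products of their entries. *)
Lemma separated_rchar : separated W'.
Proof.
have cA : mx_continuous (fun h : G => tau (h^-1)%g *m tau alpha *m tau h).
  apply: mx_continuous_mul; last exact: rep_continuous.
  apply: mx_continuous_mul; last exact: mx_continuous_cst.
  exact/mx_continuousV/rep_continuous.
set A := (fun h : G => _) in cA.
apply: (@separated_eq R G (fun g h => Num.sqrt 2 * \sum_i \sum_j
   (complex.Re (tau g j i) * complex.Re (A h i j)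
    - complex.Im (tau g j i) * complex.Im (A h i j)))).
  move=> g h; rewrite /conj_shift rcharE; congr (_ * _).
  rewrite /rep_char !rep_M -/(A h) /mxtrace raddf_sum; apply: eq_bigr => i _.
  rewrite mxE raddf_sum; apply: eq_bigr => j _.
  by case: (A h i j) => u v; case: (tau g j i) => u' v' /=; ring.
apply: separatedZ; apply: separated_sum => i; apply: separated_sum => j.
apply: separatedB; apply: Separated_mul.
- exact: (ccont_Re (@rep_continuous R G tau j i)).
- exact: (ccont_Re (cA i j)).
- exact: (ccont_Im (@rep_continuous R G tau j i)).
- exact: (ccont_Im (cA i j)).
Qed.

Let r (phi : rep R G) := char_ratio phi alpha.

Lemma rchar_regression g : mean (W' g) = r tau * W g.
Proof.
have c1 := @ccont_char_cj R G tau alpha g.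
have := char_average Gc muL alpha g tau_irr.
rewrite -(char_ratioE Gc muL tau alpha_conj) -/(r tau) => /(congr1
  (@complex.Re R)).
have -> : complex.Re ((r tau)%:C%C * rep_char tau g) =
  r tau * complex.Re (rep_char tau g).
  by case: (rep_char tau g) => u v /=; ring.
rewrite /= rcharE mulrCA => <-.
rewrite -(meanZ mu Gc _ (ccont_Re c1)); congr mean; apply/funext => h.
by rewrite /conj_shift rcharE.
Qed.

Variable s : seq (rep R G).
Hypothesis us : uniq s.
Hypothesis sirr : forall phi, phi \in s -> irr_reps phi.
Let m phi : R := (rep_mult phi rho)%:R.
Hypothesis rhoE : forall g, rep_char rho g =
  \sum_(phi <- s) (rep_mult phi rho)%:R * rep_char phi g.

Lemma expands_sqr : expands s (fun g => 2 * W g ^+ 2) m.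
Proof.
move=> g; rewrite -rep_char_square rhoE; apply: eq_bigr => phi _.
by rewrite /m rmorph_nat.
Qed.

(** Averaging over [h] acts diagonally on irreducible characters, with eigenvalues [r phi]. *)
Lemma expands_sqr' :
  expands s (fun g => 2 * mean (fun h => W' g h ^+ 2))
    (fun phi => m phi * r phi).
Proof.
have sW'2 : separated (fun g h => W' g h ^+ 2).
  by apply: separatedX; exact: separated_rchar.
move=> g.
rewrite -(meanZ mu Gc _ (separated_contr sW'2)) -cmeanR.
have cc (phi : rep R G) := @ccont_char_cj R G phi alpha g.
have -> : (fun h => (2 * W' g h ^+ 2)%:C%C) = fun h =>
   \sum_(phi <- s) (m phi)%:C%C * rep_char phi (h^-1 * alpha * h * g)%g.
  apply/funext => h; rewrite /conj_shift -rep_char_square rhoE;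
    apply: eq_bigr => phi _.
  by rewrite /m rmorph_nat.
rewrite (cmean_sum mu Gc); last by move=> phi; apply: ccontM;
  [exact: ccont_cst|exact: cc].
rewrite big_seq [RHS]big_seq; apply: eq_bigr => phi ps.
rewrite (cmeanZ mu Gc _ (cc phi)) (char_average Gc muL)//;
  last exact/irr_reps_irr/sirr.
by rewrite -(char_ratioE Gc muL phi alpha_conj) rmorphM mulrA.
Qed.

End RealCharacter.

(** * Assembly of the bound *)

Theorem theorem3p19 (R : realType) (G : topologicalGroupType)
    (n : nat) (A : set (chart R n G))
    (G_lie : lie_atlas A) (G_compact : compact [set: G])
    (mu : probability (borel G) R) (mu_haar : haar mu)
    (tau : rep R G) (tau_irr : rep_irreducible tau)
    (tau_nonreal : ~ (forall g : G, rep_char tau g \is Num.real))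
    (alpha : G) (alpha_neq1 : alpha <> 1%g)
    (alpha_conj : exists h : G, (alpha^-1 = h * alpha * h^-1)%g)
    (a : R) (a_def : a = 1 - char_ratio tau alpha) (a_neq0 : a <> 0)
    (x0 : R) :
  let W := real_char_rv tau in
  let m (phi : rep R G) : R :=
    (rep_mult phi (rep_exp (rep_dsum tau (rep_conj tau)) 2))%:R in
  `| fine (mu [set g | W g <= x0])
     - (Num.sqrt (2 * pi))^-1 *
       \int[lebesgue_measure]_(x in `]-oo, x0]) expR (- (x ^+ 2 / 2)) |
  <= 2^-1 * Num.sqrt (\sum_(phi \in irr_reps `&`
                                    [set phi | ~ rep_iso phi rep_triv])
               m phi ^+ 2 * (2 - a^-1 * (1 - char_ratio phi alpha)) ^+ 2)
     + (pi^-1 * \sum_(phi \in irr_reps)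
               m phi ^+ 2 * (2 - 3 / (2 * a) * (1 - char_ratio phi alpha)))
       `^ (4^-1).
Proof.
cbv zeta beta.
have Gc := G_compact; have muL := mu_haar.
pose W := rchar tau; pose W' := conj_shift W alpha.
set rho := rep_exp _ 2.
pose m (phi : rep R G) : R := (rep_mult phi rho)%:R.
pose r (phi : rep R G) := char_ratio phi alpha.
have [s [us sirr s0 rhoE]] := char_decomp Gc muL rho.
(* The chosen representative of the trivial class need not be [rep_triv] itself. *)
have [phi1 [[iphi1 iso1] _]] := irr_repsP (@rep_triv_irr R G).
have chi1 g : rep_char phi1 g = 1 by rewrite -(rep_char_iso iso1) rep_char_triv.
have m1 : rep_mult phi1 rho = 2%N.
  apply/eqP; rewrite -(eqr_nat R[i]); apply/eqP.
  rewrite (rep_multE Gc muL)//; last exact: irr_reps_irr.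
  rewrite -[RHS](cmean_square Gc muL tau_irr tau_nonreal); congr haar_cmean.
  by apply/funext => g; rewrite chi1 rmorph1 mulr1.
have s1 : phi1 \in s.
  by apply: contraT => /(s0 _ iphi1); rewrite m1.
have r1 : r phi1 = 1.
  apply: (@complexI R); rewrite (char_ratioE Gc muL phi1 alpha_conj) chi1.
  have [d0 _] := irr_reps_irr iphi1.
  have -> : (rep_dim phi1)%:R = 1 :> R[i].
    by rewrite -[RHS](chi1 1%g) /rep_char rep_1 mxtrace1.
  by rewrite invr1 mulr1.
have triv_iff phi : irr_reps phi -> (~ rep_iso phi rep_triv) <-> phi <> phi1.
  move=> iphi; split=> [niso e|ne iso].
    by apply: niso; rewrite e; exact: rep_iso_sym.
  by apply: ne; apply: irr_reps_iso => //; exact: rep_iso_trans iso iso1.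
have m_out phi : irr_reps phi -> phi \notin s -> m phi = 0.
  by move=> iphi ps; rewrite /m s0.
have cW : continuous W := @continuous_rchar R G tau.
have sW' : separated W' := @separated_rchar R G tau alpha.
have reg g : haar_mean mu (W' g) = (1 - a) * W g.
  rewrite (rchar_regression Gc muL tau_irr alpha_conj) a_def; congr (_ * _).
  by rewrite /r; ring.
have Wvar : haar_mean mu (fun g => W g ^+ 2) = 1.
  exact: (rchar_var Gc muL tau_irr tau_nonreal).
have E2 := mean2_sqr Gc muL cW alpha_conj sW' reg.
have E4 := mean2_pow4 Gc muL cW alpha_conj sW' reg.
rewrite -/W' Wvar mulr1 in E2; rewrite -/W' in E4.
have sd : separated (fun g h => W' g h - W g).
  by apply: separatedB => //; exact: separated_l.
have sd2 : separated (fun g h => (W' g h - W g) ^+ 2) by exact: separatedX.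
have sd4 : separated (fun g h => (W' g h - W g) ^+ 4) by exact: separatedX.
(* The mean of the squared increment is [2 * a]. *)
have a_gt0 : 0 < a.
  rewrite lt_neqAle eq_sym; apply/andP; split; first exact/eqP.
  have : mean2 mu (fun _ _ => 0) <= mean2 mu (fun g h => (W' g h - W g) ^+ 2).
    apply: (mean2_le mu Gc _ sd2) => [|g h]; last exact: sqr_ge0.
    by apply: separated_l; exact: continuous_cst_real.
  by rewrite E2 /mean2 !mean_cst pmulr_rge0.
pose T g := haar_mean mu (fun h => W' g h ^+ 2).
have Ew : expands s (fun g => 2 * W g ^+ 2) m := expands_sqr rhoE.
have Ew' : expands s (fun g => 2 * T g) (fun phi => m phi * r phi) :=
  expands_sqr' Gc muL alpha_conj sirr rhoE.
pose S := \sum_(phi <- s) m phi ^+ 2 * (2 - 3 / (2 * a) * (1 - r phi)).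
have cW2 : continuous (fun g => W g ^+ 2).
  rewrite (_ : (fun _ => _) = fun g => W g * W g);
    first exact: (continuousM_real cW cW).
  by apply/funext => g; rewrite expr2.
have cT : continuous T.
  have sW'2 : separated (fun g h => W' g h ^+ 2) by exact: separatedX.
  by have [] := separated_mean mu Gc sW'2.
have M4 : 4 * haar_mean mu (fun g => W g ^+ 4) = \sum_(phi <- s) m phi ^+ 2.
  have cW4 : continuous (fun g => W g ^+ 4).
    rewrite (_ : (fun _ => _) = fun g => W g ^+ 2 * W g ^+ 2).
      exact: (continuousM_real cW2 cW2).
    by apply/funext => g; ring.
  have := parseval Gc muL us sirr Ew Ew; rewrite -(meanZ mu Gc _ cW4).
  under [in X in _ = X -> _]eq_bigr do rewrite -expr2.
  by move=> <-; congr haar_mean; apply/funext => g; ring.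
have M22 : 4 * haar_mean mu (fun g => W g ^+ 2 * T g) =
  \sum_(phi <- s) m phi ^+ 2 * r phi.
  have := parseval Gc muL us sirr Ew Ew'.
  rewrite -(meanZ mu Gc _ (continuousM_real cW2 cT)).
  under [in X in _ = X -> _]eq_bigr do rewrite mulrA -expr2.
  by move=> <-; congr haar_mean; apply/funext => g; ring.
have ES : mean2 mu (fun g h => (W' g h - W g) ^+ 4) = a * S.
  have -> : a * S = \sum_(phi <- s)
      ((8 * a - 6) / 4 * m phi ^+ 2 + 6 / 4 * (m phi ^+ 2 * r phi)).
    rewrite /S mulr_sumr; apply: eq_bigr => phi _; field.
    exact/eqP.
  by rewrite big_split -!mulr_sumr -M4 -M22 E4 /=; field.
have S_gt0 : 0 < S.
  (* The fourth moment is at least the square of the second, [4 * a ^+ 2], because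
     [((W' - W) ^+ 2 - 2 * a) ^+ 2] is nonnegative. *)
  have : mean2 mu (fun g h => 4 * a * (W' g h - W g) ^+ 2 + - (4 * a ^+ 2)) <=
      mean2 mu (fun g h => (W' g h - W g) ^+ 4).
    apply: (mean2_le mu Gc _ sd4) => [|g h].
      apply: Separated_add; first exact: separatedZ.
      by apply: separated_l; exact: continuous_cst_real.
    rewrite -subr_ge0 (_ : _ - _ =
      ((W' g h - W g) ^+ 2 - 2 * a) ^+ 2) ?sqr_ge0//.
    ring.
  rewrite (mean2D mu Gc (separatedZ _ sd2) (separated_l
    (@continuous_cst_real _ _ _))).
  rewrite (mean2Z mu Gc _ sd2) E2 /mean2 !mean_cst -/(mean2 mu _) ES => h.
  rewrite -(pmulr_rgt0 _ a_gt0); apply: lt_le_trans h.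
  rewrite (_ : _ + _ = 4 * a ^+ 2); last by ring.
  by rewrite mulr_gt0// exprn_gt0.
have := normal_approx Gc muL cW alpha_conj sW' reg a_gt0 Wvar x0 S_gt0 ES.
(* The coefficients of -4 times [1 - (2 * a)^-1 * cond_sqr]; the constant contributes only at the
   trivial character. *)
pose b phi := (2 - a^-1) * m phi + (a^-1 * (m phi * r phi) + -4 *
  (phi == phi1)%:R).
have Eone : expands s (fun=> 1) (fun phi => (phi == phi1)%:R).
  move=> g; rewrite (bigD1_seq phi1)//= big1 => [|phi /negbTE ->].
    by rewrite eqxx chi1 mulr1 addr0.
  by rewrite mul0r.
have Eb := expandsD (expandsZ (2 - a^-1) Ew)
  (expandsD (expandsZ a^-1 Ew') (expandsZ (-4) Eone)).
have a00 : a != 0 by exact/eqP.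
have -> : haar_mean mu (fun g => (1 -
  (2 * a)^-1 * cond_sqr mu W alpha g) ^+ 2) =
    16^-1 * \sum_(phi <- s) b phi ^+ 2.
  have := parseval Gc muL us sirr (expandsZ 4^-1 Eb) (expandsZ 4^-1 Eb).
  rewrite mulr_sumr => E; transitivity (\sum_(phi <- s) 4^-1 * b phi *
    (4^-1 * b phi)).
    rewrite -[RHS]E; congr haar_mean; apply/funext => g.
    rewrite (cond_sqrE Gc sW' reg) -/(T g); field.
    by rewrite a00.
  by apply: eq_bigr => phi _; field.
(* The multiplicity 2 cancels the constant -4, so the first sum omits the trivial representation. *)
have b1 : b phi1 = 0.
  by rewrite /b r1 /m m1 eqxx /= !mulr1; field; rewrite ?a00.
have bE phi : phi != phi1 -> b phi = m phi * (2 - a^-1 * (1 - r phi)).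
  by move=> /negbTE ne; rewrite /b ne /= mulr0 addr0; ring.
set A1 := _ `&` _.
have -> : \sum_(phi \in A1) m phi ^+ 2 * (2 - a^-1 *
  (1 - char_ratio phi alpha)) ^+ 2 =
    \sum_(phi <- s) b phi ^+ 2.
  rewrite (@fsbigE _ _ _ _ A1 [seq phi <- s | phi != phi1]).
  - rewrite big_filter_cond big_mkcond big_seq [RHS]big_seq;
    apply: eq_bigr => phi ps.
    have iphi := sirr _ ps.
    have [->|ne] := eqVneq phi phi1; first by rewrite /= b1 expr0n.
    rewrite /= mem_set; first by rewrite bE// exprMn.
    by split => //; apply/triv_iff => //; exact/eqP.
  - exact: filter_uniq.
  - move=> phi /=; rewrite mem_filter => /andP[/eqP ne /sirr iphi]; split => //.
    exact/triv_iff.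
  - move=> phi [iphi /(triv_iff _ iphi)/eqP ne].
    rewrite mem_filter ne /= => ps.
    by rewrite m_out// expr0n mul0r.
have -> : \sum_(phi \in irr_reps)
    m phi ^+ 2 * (2 - 3 / (2 * a) * (1 - char_ratio phi alpha)) = S.
  rewrite (@fsbigE _ _ _ _ irr_reps s) //.
  - rewrite big_mkcond /S big_seq [RHS]big_seq; apply: eq_bigr => phi ps.
    by rewrite mem_set//; exact: sirr.
  - by move=> phi iphi ps; rewrite m_out// expr0n mul0r.
move=> main; apply: (le_trans main); rewrite lerD2r.
set B := \sum_(phi <- s) _.
have B0 : 0 <= B by apply: sumr_ge0 => phi _; exact: sqr_ge0.
rewrite sqrtrM ?invr_ge0// ler_wpM2r ?sqrtr_ge0//.
have -> : 16^-1 = (4^-1) ^+ 2 :> R by field.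
(* The factor obtained is 1/4, at most the 1/2 of the statement. *)
by rewrite sqrtr_sqr ger0_norm ?invr_ge0// lef_pV2 ?posrE// ler_nat.
Qed.
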